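(* Let $|q|<1$ and let $a,b,d,z$ be nonzero complex parameters such that no denominator below vanishes. Define $G_6(a,b,d,z,q)=\sum_{r=-\infty}^{\infty}\frac{(a;q^2)_rz^rq^{r^2}}{(b,d;q^2)_r}$. (i) If $|bd/(azq)|<1$, then $$G_6(a,b,d,z,q)=\frac{(-zq,-qb/(az),-qd/(az);q^2)_{\infty}}{(b,d,q^2/a;q^2)_{\infty}}\sum_{r=-\infty}^{\infty}\frac{(-azq/b,-azq/d;q^2)_r}{(-zq;q^2)_r}\left(\frac{-bd}{azq}\right)^r.$$ (ii) If $|bd/(azq)|<1$ and $|b/a|<1$, then $$G_6(a,b,d,z,q)=\frac{(b/a,-qb/(az);q^2)_{\infty}}{(b,-bd/(azq);q^2)_{\infty}}\sum_{r=-\infty}^{\infty}\frac{(-azq/b,a;q^2)_r}{(d;q^2)_r}\left(\frac{b}{a}\right)^r.$$ (iii) If $|bd/(azq)|<1$, then $$G_6(a,b,d,z,q)=\frac{(-bq/(az),-dq/(az),-qz;q^2)_{\infty}}{(-bd/(aqz),-q^3/(az),-aqz;q^2)_{\infty}}\sum_{r=-\infty}^{\infty}\frac{(1+azq^{4r-1})(a,-azq/b,-azq/d;q^2)_r(bdz)^rq^{3r^2-4r}}{(1+az/q)(b,d,-zq;q^2)_r}.$$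
   Context: For $n\ge 0$, $(a;q)_n=\prod_{j=0}^{n-1}(1-aq^j)$, $(a;q)_\infty=\prod_{j\ge0}(1-aq^j)$, and for negative index $(a;q)_{-n}=1/(aq^{-n};q)_n$. Also $(a_1,\dots,a_k;q)_n=(a_1;q)_n\cdots(a_k;q)_n$ (same for $n=\infty$). *)

(* Defs.v *)
From Stdlib Require Import Reals ZArith ClassicalEpsilon.
Open Scope R_scope.

Definition Cx : Type := (R * R)%type.
Definition RtoC (x : R) : Cx := (x, 0).
Definition Czero : Cx := (0, 0).
Definition Cone : Cx := (1, 0).
Definition Cadd (u v : Cx) : Cx := (fst u + fst v, snd u + snd v).
Definition Copp (u : Cx) : Cx := (- fst u, - snd u).
Definition Csub (u v : Cx) : Cx := Cadd u (Copp v).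
Definition Cmul (u v : Cx) : Cx :=
  (fst u * fst v - snd u * snd v, fst u * snd v + snd u * fst v).
(* multiplicative inverse; Cinv Czero = Czero (total convention, never used under the hypotheses) *)
Definition Cinv (u : Cx) : Cx :=
  let n := fst u * fst u + snd u * snd u in (fst u / n, - snd u / n).
Definition Cdiv (u v : Cx) : Cx := Cmul u (Cinv v).
Definition Cnorm (u : Cx) : R := sqrt (fst u * fst u + snd u * snd u).

Declare Scope C_scope.
Delimit Scope C_scope with Cx.
Notation "x + y" := (Cadd x y) : C_scope.
Notation "x - y" := (Csub x y) : C_scope.
Notation "- x" := (Copp x) : C_scope.
Notation "x * y" := (Cmul x y) : C_scope.
Notation "x / y" := (Cdiv x y) : C_scope.

Fixpoint Cpow (u : Cx) (n : nat) : Cx :=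
  match n with O => Cone | S m => Cmul (Cpow u m) u end.
Definition Cpowz (u : Cx) (k : Z) : Cx :=
  match k with
  | Z0 => Cone
  | Zpos p => Cpow u (Pos.to_nat p)
  | Zneg p => Cinv (Cpow u (Pos.to_nat p))
  end.

Fixpoint qpoch (x p : Cx) (n : nat) : Cx :=
  match n with
  | O => Cone
  | S m => Cmul (qpoch x p m) (Csub Cone (Cmul x (Cpow p m)))
  end.

Definition qpochZ (x p : Cx) (r : Z) : Cx :=
  match r with
  | Zneg m => Cinv (qpoch (Cmul x (Cinv (Cpow p (Pos.to_nat m)))) p (Pos.to_nat m))
  | _ => qpoch x p (Z.to_nat r)
  end.

(* the (hidden) denominator in the definition of (x;p)_r is nonzero
   (only relevant for r < 0) *)
Definition qdef (x p : Cx) (r : Z) : Prop :=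
  match r with
  | Zneg m => qpoch (Cmul x (Cinv (Cpow p (Pos.to_nat m)))) p (Pos.to_nat m) <> Czero
  | _ => True
  end.

Definition qnz (x p : Cx) (r : Z) : Prop := qdef x p r /\ qpochZ x p r <> Czero.

Definition Ccv (u : nat -> Cx) (l : Cx) : Prop :=
  Un_cv (fun n => Cnorm (Csub (u n) l)) 0.

(* the limit of a sequence (chosen by classical choice; meaningful when it converges) *)
Definition Clim (u : nat -> Cx) : Cx :=
  epsilon (inhabits Czero) (fun l => Ccv u l).

Definition qinf (x p : Cx) : Cx := Clim (fun n => qpoch x p n).

Fixpoint Csum (f : nat -> Cx) (n : nat) : Cx :=
  match n with O => f O | S m => Cadd (Csum f m) (f (S m)) end.

Definition bisum_cv (f : Z -> Cx) (Ssum : Cx) : Prop :=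
  exists S1 S2,
    Ccv (Csum (fun k => f (Z.of_nat k))) S1 /\
    Ccv (Csum (fun k => f (- Z.of_nat (Datatypes.S k))%Z)) S2 /\
    Ssum = Cadd S1 S2.

Definition G6term (a b d z q : Cx) (r : Z) : Cx :=
  let p := Cmul q q in
  Cdiv (Cmul (Cmul (qpochZ a p r) (Cpowz z r)) (Cpowz q (r * r)))
       (Cmul (qpochZ b p r) (qpochZ d p r)).

(* Main.v *)
(* All three identities are limits of terminating ones. With p = q^2 and w = -bd/(azq), replace
   a, b, d by a p^-N, b p^-N, d p^-N in a terminating 3phi2 of length 2N and index its terms by
   r = i - N: up to a constant, its r-th term is the r-th term of G_6 times a weight that is bounded
   and converges as N -> oo, so Tannery's theorem gives G_6. Transforming the 3phi2 by (III.13) of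
   Gasper and Rahman yields (ii), iterating that transformation yields (i), and the confluent case
   of Watson's transformation to a very-well-poised series yields (iii). *)

Require Import Defs.
From Stdlib Require Import Reals ZArith Lia Lra Psatz ClassicalEpsilon.
Open Scope R_scope.

Local Open Scope C_scope.
Local Arguments Cnorm u%_Cx.

(** The shift by p^-N centres the terminating series: for fixed r both i = N + r and the
    complementary index j = N - r tend to infinity, which is why the length is 2N. The parameter w
    stays unshifted, so that its factorials become convergent weights. Absorbing (p^-n;p)_i into a
    Gaussian binomial in i and j removes the negative powers of p, makes every terminating sum
    accessible to an induction by q-Pascal, and splits the weight into convergent sequences in i +
    j, i and j separately. Terminating and bilateral terms are identified by comparing first-order
    recurrences in u = p^r, not by manipulating factorials of negative index. The obstacle is that
    constants such as (x p^-N;p)_N diverge in general: before N tends to infinity they have to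
    cancel exactly or be reflected into (p/x;p)_N. The powers left over by the reflections match
    because w c = d and w f = b for c = -azq/b and f = -azq/d. *)

(** * The field of complex numbers *)

Lemma Cx_ext (u v : Cx) : fst u = fst v -> snd u = snd v -> u = v.
Proof. destruct u, v; simpl; intros; subst; reflexivity. Qed.

Lemma Cx_ring_theory : ring_theory Czero Cone Cadd Cmul Csub Copp (@eq Cx).
Proof.
  split; intros; apply Cx_ext; unfold Cadd, Cmul, Csub, Copp, Czero, Cone, Cadd; simpl; ring.
Qed.

Lemma Cx_sqr_neq_0 (u : Cx) : u <> Czero -> (fst u * fst u + snd u * snd u)%R <> 0%R.
Proof.
  intros H E; apply H; apply Cx_ext; simpl; nra.
Qed.

Lemma Cinv_l (u : Cx) : u <> Czero -> Cinv u * u = Cone.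
Proof.
  intros H; apply Cx_sqr_neq_0 in H.
  apply Cx_ext; unfold Cinv; simpl; field; exact H.
Qed.

Lemma Cone_neq_0 : Cone <> Czero.
Proof. intros H; injection H; lra. Qed.

Lemma Cx_field_theory : field_theory Czero Cone Cadd Cmul Csub Copp Cdiv Cinv (@eq Cx).
Proof.
  split; [exact Cx_ring_theory | exact Cone_neq_0 | reflexivity | exact Cinv_l].
Qed.

Add Field Cx_field : Cx_field_theory.

Lemma Cmul_neq_0 (u v : Cx) : u <> Czero -> v <> Czero -> u * v <> Czero.
Proof.
  intros Hu Hv H; apply Hv.
  replace v with (Cinv u * (u * v)) by (field; exact Hu).
  rewrite H; ring.
Qed.

Lemma Cmul_neq_0_inv (u v : Cx) : u * v <> Czero -> u <> Czero /\ v <> Czero.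
Proof. split; intros ->; apply H; ring. Qed.

Lemma Cinv_neq_0 (u : Cx) : u <> Czero -> Cinv u <> Czero.
Proof.
  intros Hu H; apply Cone_neq_0.
  rewrite <- (Cinv_l u Hu), H; ring.
Qed.

Lemma Copp_neq_0 (u : Cx) : u <> Czero -> - u <> Czero.
Proof.
  intros Hu H; apply Hu; replace u with (- - u) by ring; rewrite H; ring.
Qed.

Lemma Cdiv_neq_0 (u v : Cx) : u <> Czero -> v <> Czero -> u / v <> Czero.
Proof. intros Hu Hv; apply Cmul_neq_0; [exact Hu | apply Cinv_neq_0, Hv]. Qed.

Lemma Cmul_cancel_l (u v v' : Cx) : u <> Czero -> u * v = u * v' -> v = v'.
Proof.
  intros Hu H; replace v with (Cinv u * (u * v)) by (field; exact Hu).
  rewrite H; field; exact Hu.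
Qed.

(** * The modulus and convergence *)

Lemma Cnorm_ge_0 (u : Cx) : (0 <= Cnorm u)%R.
Proof. apply sqrt_pos. Qed.

Lemma Cnorm_sqr (u : Cx) : (Cnorm u * Cnorm u = fst u * fst u + snd u * snd u)%R.
Proof. apply sqrt_sqrt; nra. Qed.

Lemma Cnorm_mul (u v : Cx) : Cnorm (u * v) = (Cnorm u * Cnorm v)%R.
Proof.
  unfold Cnorm; rewrite <- sqrt_mult_alt by nra; simpl.
  apply (f_equal sqrt); ring.
Qed.

Lemma Cnorm_opp (u : Cx) : Cnorm (- u) = Cnorm u.
Proof. unfold Cnorm; simpl; apply (f_equal sqrt); ring. Qed.

Lemma Cnorm_0 : Cnorm Czero = 0%R.
Proof. unfold Cnorm; simpl; replace (0 * 0 + 0 * 0)%R with 0%R by ring; apply sqrt_0. Qed.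

Lemma Cnorm_1 : Cnorm Cone = 1%R.
Proof. unfold Cnorm; simpl; replace (1 * 1 + 0 * 0)%R with 1%R by ring; apply sqrt_1. Qed.

Lemma Cnorm_eq_0 (u : Cx) : Cnorm u = 0%R -> u = Czero.
Proof.
  intros H; pose proof (Cnorm_sqr u) as E; rewrite H in E.
  apply Cx_ext; simpl; nra.
Qed.

Lemma Cnorm_gt_0 (u : Cx) : u <> Czero -> (0 < Cnorm u)%R.
Proof.
  intros H; destruct (Cnorm_ge_0 u) as [L | E]; [exact L |].
  contradiction H; apply Cnorm_eq_0; auto.
Qed.

Lemma Cnorm_add (u v : Cx) : (Cnorm (u + v) <= Cnorm u + Cnorm v)%R.
Proof.
  pose proof (Cnorm_ge_0 u); pose proof (Cnorm_ge_0 v).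
  assert (CS : (fst u * fst v + snd u * snd v <= Cnorm u * Cnorm v)%R).
  { rewrite <- Cnorm_mul.
    apply Rle_trans with (Rabs (fst u * fst v + snd u * snd v)%R); [apply Rle_abs |].
    rewrite <- sqrt_Rsqr_abs; unfold Cnorm, Rsqr; apply sqrt_le_1_alt; simpl.
    (* Lagrange's identity: the squared modulus of u v is the square of the real inner product plus
       this square. *)
    pose proof (Rle_0_sqr (fst u * snd v - snd u * fst v)%R) as Q; unfold Rsqr in Q.
    nra. }
  apply Rsqr_incr_0_var; [| lra]; unfold Rsqr.
  rewrite Cnorm_sqr; simpl.
  pose proof (Cnorm_sqr u); pose proof (Cnorm_sqr v); nra.
Qed.

Lemma Cnorm_sub (u v : Cx) : (Cnorm (u - v) <= Cnorm u + Cnorm v)%R.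
Proof. unfold Csub; rewrite <- (Cnorm_opp v); apply Cnorm_add. Qed.

Lemma Cnorm_sub_ge (u v : Cx) : (Cnorm u - Cnorm v <= Cnorm (u - v))%R.
Proof.
  pose proof (Cnorm_add (u - v) v) as H.
  replace (u - v + v) with u in H by ring; lra.
Qed.

Lemma Cnorm_sub_sym (u v : Cx) : Cnorm (u - v) = Cnorm (v - u).
Proof. rewrite <- Cnorm_opp; f_equal; ring. Qed.

Lemma Cnorm_inv (u : Cx) : u <> Czero -> Cnorm (Cinv u) = (/ Cnorm u)%R.
Proof.
  intros H; pose proof (Cnorm_gt_0 u H).
  apply Rmult_eq_reg_r with (Cnorm u); [| lra].
  rewrite <- Cnorm_mul, (Cinv_l u H), Cnorm_1; field; lra.
Qed.

Lemma Rabs_fst_le_Cnorm (u : Cx) : (Rabs (fst u) <= Cnorm u)%R.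
Proof. rewrite <- sqrt_Rsqr_abs; apply sqrt_le_1_alt; unfold Rsqr; nra. Qed.

Lemma Rabs_snd_le_Cnorm (u : Cx) : (Rabs (snd u) <= Cnorm u)%R.
Proof. rewrite <- sqrt_Rsqr_abs; apply sqrt_le_1_alt; unfold Rsqr; nra. Qed.

Lemma Cnorm_le_Rabs (u : Cx) : (Cnorm u <= Rabs (fst u) + Rabs (snd u))%R.
Proof.
  pose proof (Rabs_pos (fst u)); pose proof (Rabs_pos (snd u)).
  apply Rsqr_incr_0_var; [| lra]; unfold Rsqr; rewrite Cnorm_sqr.
  pose proof (Rsqr_abs (fst u)) as E1; pose proof (Rsqr_abs (snd u)) as E2; unfold Rsqr in *.
  nra.
Qed.

Lemma Un_cv_0_le (u v : nat -> R) (K : nat) :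
  (forall n, (K <= n)%nat -> (Rabs (u n) <= v n)%R) -> Un_cv v 0 -> Un_cv u 0.
Proof.
  intros Hle Hv eps Heps; destruct (Hv eps Heps) as [M HM].
  exists (max K M); intros n Hn.
  specialize (HM n ltac:(lia)); specialize (Hle n ltac:(lia)).
  unfold Rdist in *; rewrite Rminus_0_r in *.
  pose proof (Rle_abs (v n)); lra.
Qed.

Lemma Un_cv_const (c : R) : Un_cv (fun _ => c) c.
Proof. intros eps H; exists 0%nat; intros; rewrite Rdist_eq; lra. Qed.

Lemma Ccv_le (u : nat -> Cx) (l : Cx) (v : nat -> R) (K : nat) :
  (forall n, (K <= n)%nat -> (Cnorm (u n - l) <= v n)%R) -> Un_cv v 0 -> Ccv u l.
Proof.
  intros H Hv; apply (Un_cv_0_le _ v K); [| exact Hv].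
  intros n Hn; rewrite Rabs_pos_eq by apply Cnorm_ge_0; apply H, Hn.
Qed.

Lemma Ccv_ext (u v : nat -> Cx) (l : Cx) : (forall n, u n = v n) -> Ccv u l -> Ccv v l.
Proof.
  intros E Hu eps Heps; destruct (Hu eps Heps) as [M HM]; exists M; intros n Hn.
  rewrite <- E; apply HM, Hn.
Qed.

Lemma Ccv_const (c : Cx) : Ccv (fun _ => c) c.
Proof.
  apply (Ccv_le _ _ (fun _ => 0%R) 0); [| apply Un_cv_const].
  intros; replace (c - c) with Czero by ring; rewrite Cnorm_0; lra.
Qed.

(** The growth bound sends [s n] to infinity without monotonicity; the offset [K] admits truncated
    differences such as n - k. *)
Lemma Ccv_subseq (u : nat -> Cx) (l : Cx) (s : nat -> nat) (K : nat) :
  (forall n, (n <= s (n + K))%nat) -> Ccv u l -> Ccv (fun n => u (s n)) l.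
Proof.
  intros Hs Hu eps Heps; destruct (Hu eps Heps) as [M HM]; exists (M + K)%nat.
  intros n Hn; apply HM.
  specialize (Hs (n - K)%nat); replace (n - K + K)%nat with n in Hs by lia; lia.
Qed.

Lemma Ccv_add (u v : nat -> Cx) (l m : Cx) :
  Ccv u l -> Ccv v m -> Ccv (fun n => u n + v n) (l + m).
Proof.
  intros Hu Hv; apply (Ccv_le _ _ (fun n => Cnorm (u n - l) + Cnorm (v n - m))%R 0).
  - intros n _; replace (u n + v n - (l + m)) with ((u n - l) + (v n - m)) by ring.
    apply Cnorm_add.
  - rewrite <- (Rplus_0_r 0); apply CV_plus; assumption.
Qed.

Lemma Ccv_bounded (u : nat -> Cx) (l : Cx) :
  Ccv u l -> exists M, (0 <= M)%R /\ forall n, (Cnorm (u n) <= M)%R.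
Proof.
  intros Hu; destruct (Hu 1%R Rlt_0_1) as [K HK].
  assert (Hfin : forall m, exists M, (0 <= M)%R /\ forall n, (n < m)%nat -> (Cnorm (u n) <= M)%R).
  { induction m as [| m [M [HM0 HM]]].
    - exists 0%R; split; [lra | intros; lia].
    - exists (M + Cnorm (u m))%R; pose proof (Cnorm_ge_0 (u m)); split; [lra |].
      intros n Hn; destruct (Nat.eq_dec n m) as [-> | Hne]; [lra |].
      specialize (HM n ltac:(lia)); lra. }
  destruct (Hfin K) as [M [HM0 HM]]; pose proof (Cnorm_ge_0 l).
  exists (M + (Cnorm l + 1))%R; split; [lra |].
  intros n; destruct (Nat.lt_ge_cases n K) as [Hn | Hn]; [specialize (HM n Hn); lra |].
  specialize (HK n Hn); unfold Rdist in HK; rewrite Rminus_0_r, Rabs_pos_eq in HK by apply Cnorm_ge_0.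
  pose proof (Cnorm_sub_ge (u n) l); lra.
Qed.

Lemma Un_cv_scal_0 (c : R) (v : nat -> R) : Un_cv v 0 -> Un_cv (fun n => c * v n)%R 0.
Proof. intros H; rewrite <- (Rmult_0_r c); apply CV_mult; [apply Un_cv_const | exact H]. Qed.

Lemma Ccv_mul (u v : nat -> Cx) (l m : Cx) :
  Ccv u l -> Ccv v m -> Ccv (fun n => u n * v n) (l * m).
Proof.
  intros Hu Hv; destruct (Ccv_bounded u l Hu) as [M [HM0 HM]].
  apply (Ccv_le _ _ (fun n => M * Cnorm (v n - m) + Cnorm m * Cnorm (u n - l))%R 0).
  - intros n _.
    replace (u n * v n - l * m) with (u n * (v n - m) + m * (u n - l)) by ring.
    eapply Rle_trans; [apply Cnorm_add |]; rewrite !Cnorm_mul.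
    pose proof (HM n); pose proof (Cnorm_ge_0 (v n - m)); nra.
  - rewrite <- (Rplus_0_r 0); apply CV_plus; apply Un_cv_scal_0; assumption.
Qed.

Lemma Ccv_opp (u : nat -> Cx) (l : Cx) : Ccv u l -> Ccv (fun n => - u n) (- l).
Proof.
  intros Hu; apply (Ccv_le _ _ (fun n => Cnorm (u n - l)) 0); [| exact Hu].
  intros n _; replace (- u n - - l) with (- (u n - l)) by ring; rewrite Cnorm_opp; lra.
Qed.

Lemma Ccv_sub (u v : nat -> Cx) (l m : Cx) :
  Ccv u l -> Ccv v m -> Ccv (fun n => u n - v n) (l - m).
Proof. intros Hu Hv; apply Ccv_add; [exact Hu | apply Ccv_opp, Hv]. Qed.

Lemma Ccv_inv (u : nat -> Cx) (l : Cx) :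
  l <> Czero -> Ccv u l -> Ccv (fun n => Cinv (u n)) (Cinv l).
Proof.
  intros Hl Hu; pose proof (Cnorm_gt_0 l Hl) as Hl0.
  destruct (Hu (Cnorm l / 2)%R ltac:(lra)) as [K HK].
  apply (Ccv_le _ _ (fun n => (2 / (Cnorm l * Cnorm l)) * Cnorm (u n - l))%R K);
    [| apply Un_cv_scal_0, Hu].
  intros n Hn; specialize (HK n Hn).
  unfold Rdist in HK; rewrite Rminus_0_r, Rabs_pos_eq in HK by apply Cnorm_ge_0.
  assert (Hbig : (Cnorm l / 2 < Cnorm (u n))%R).
  { pose proof (Cnorm_sub_ge l (u n)) as H; rewrite Cnorm_sub_sym in H; lra. }
  assert (Hun : u n <> Czero) by (intros E; rewrite E, Cnorm_0 in Hbig; lra).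
  replace (Cinv (u n) - Cinv l) with (- (u n - l) * (Cinv (u n) * Cinv l)) by (field; auto).
  rewrite !Cnorm_mul, Cnorm_opp, !Cnorm_inv by auto.
  rewrite Rmult_comm; apply Rmult_le_compat_r; [apply Cnorm_ge_0 |].
  replace (2 / (Cnorm l * Cnorm l))%R with (/ (Cnorm l / 2) * / Cnorm l)%R by (field; lra).
  apply Rmult_le_compat_r; [apply Rlt_le, Rinv_0_lt_compat, Hl0 |].
  apply Rinv_le_contravar; lra.
Qed.

Lemma Ccv_div (u v : nat -> Cx) (l m : Cx) :
  m <> Czero -> Ccv u l -> Ccv v m -> Ccv (fun n => u n / v n) (l / m).
Proof. intros Hm Hu Hv; apply Ccv_mul; [exact Hu | apply Ccv_inv; assumption]. Qed.

Lemma Ccv_unique (u : nat -> Cx) (l m : Cx) : Ccv u l -> Ccv u m -> l = m.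
Proof.
  intros Hl Hm; pose proof (Ccv_sub _ _ _ _ Hl Hm) as H.
  assert (E : Cnorm (l - m) = 0%R).
  { apply (UL_sequence (fun n => Cnorm (u n - u n - (l - m)))).
    - intros eps Heps; exists 0%nat; intros n _.
      replace (u n - u n - (l - m)) with (- (l - m)) by ring.
      rewrite Cnorm_opp, Rdist_eq; exact Heps.
    - exact H. }
  apply Cnorm_eq_0 in E; replace l with (l - m + m) by ring; rewrite E; ring.
Qed.

Lemma Csum_ext_le (f g : nat -> Cx) (n : nat) :
  (forall k, (k <= n)%nat -> f k = g k) -> Csum f n = Csum g n.
Proof.
  induction n as [| n IH]; intros H; simpl; [apply H; lia |].
  rewrite IH by (intros; apply H; lia); rewrite H by lia; reflexivity.
Qed.

Lemma Csum_split (f : nat -> Cx) (n m : nat) :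
  Csum f (n + S m) = Csum f n + Csum (fun k => f (S n + k)%nat) m.
Proof.
  induction m as [| m IH].
  - rewrite Nat.add_1_r; simpl; rewrite Nat.add_0_r; reflexivity.
  - rewrite Nat.add_succ_r; cbn [Csum]; rewrite IH.
    replace (S (n + S m)) with (S n + S m)%nat by lia; ring.
Qed.

Lemma Csum_rev (f : nat -> Cx) (n : nat) : Csum f n = Csum (fun k => f (n - k)%nat) n.
Proof.
  induction n as [| n IH]; [reflexivity |].
  transitivity (Csum (fun k => f (S n - k)%nat) (0 + S n)); [| reflexivity].
  rewrite Csum_split; simpl; rewrite IH; ring.
Qed.

Lemma Csum_sub_scal (f g : nat -> Cx) (c : Cx) (n : nat) :
  Csum f n - c * Csum g n = Csum (fun k => f k - c * g k) n.
Proof. induction n as [| n IH]; simpl; [reflexivity | rewrite <- IH; ring]. Qed.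

Lemma Cnorm_Csum (f : nat -> Cx) (n : nat) :
  (Cnorm (Csum f n) <= sum_f_R0 (fun k => Cnorm (f k)) n)%R.
Proof.
  induction n as [| n IH]; simpl; [lra |].
  eapply Rle_trans; [apply Cnorm_add | lra].
Qed.

(** * Geometric domination and Tannery's theorem *)

(** Increments telescope against the geometric series, so [v] is Cauchy; keeping the exact
    difference r^n - r^(n+k) in [Hd] is what lets the induction on k close. *)
Lemma Un_cv_of_geometric_increments (v : nat -> R) (C r : R) :
  (0 < r < 1)%R -> (forall n, (Rabs (v (S n) - v n) <= C * r ^ n)%R) -> exists l, Un_cv v l.
Proof.
  intros Hr Hv.
  assert (HC : (0 <= C)%R) by (specialize (Hv 0%nat); pose proof (Rabs_pos (v 1%nat - v 0%nat)); simpl in Hv; lra).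
  assert (Hd : forall n k, (Rabs (v (n + k)%nat - v n) <= C * (r ^ n - r ^ (n + k)) / (1 - r))%R).
  { intros n; induction k as [| k IH].
    - rewrite Nat.add_0_r, Rminus_diag, Rabs_R0; right; field; lra.
    - rewrite Nat.add_succ_r.
      replace (v (S (n + k)) - v n)%R with ((v (S (n + k)) - v (n + k)%nat) + (v (n + k)%nat - v n))%R by ring.
      eapply Rle_trans; [apply Rabs_triang |]; specialize (Hv (n + k)%nat).
      replace (C * (r ^ n - r ^ S (n + k)) / (1 - r))%R
        with (C * r ^ (n + k) + C * (r ^ n - r ^ (n + k)) / (1 - r))%R by (simpl; field; lra).
      lra. }
  destruct (R_complete v) as [l Hl]; [| exists l; exact Hl].
  intros eps Heps.
  (* The denominator C + 1 keeps the threshold meaningful when C = 0. *)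
  destruct (pow_lt_1_zero r ltac:(rewrite Rabs_pos_eq; lra) (eps * (1 - r) / (2 * (C + 1)))%R) as [K HK].
  { apply Rdiv_lt_0_compat; nra. }
  specialize (HK K (Nat.le_refl K)); rewrite Rabs_pos_eq in HK by (apply pow_le; lra).
  assert (Hb : forall n, (K <= n)%nat -> (Rabs (v n - v K) < eps / 2)%R).
  { intros n Hn; replace n with (K + (n - K))%nat by lia.
    eapply Rle_lt_trans; [apply Hd |].
    assert (0 < r ^ (K + (n - K)))%R by (apply pow_lt; lra).
    assert (0 < r ^ K)%R by (apply pow_lt; lra).
    apply Rmult_lt_reg_r with (1 - r)%R; [lra |].
    replace (C * (r ^ K - r ^ (K + (n - K))) / (1 - r) * (1 - r))%R
      with (C * (r ^ K - r ^ (K + (n - K))))%R by (field; lra).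
    apply Rle_lt_trans with (C * r ^ K)%R; [nra |].
    assert (r ^ K * (C + 1) < eps / 2 * (1 - r))%R; [| nra].
    replace (eps / 2 * (1 - r))%R with (eps * (1 - r) / (2 * (C + 1)) * (C + 1))%R by (field; lra).
    apply Rmult_lt_compat_r; lra. }
  exists K; intros n m Hn Hm; unfold Rdist.
  replace (v n - v m)%R with ((v n - v K) - (v m - v K))%R by ring.
  eapply Rle_lt_trans; [apply Rabs_triang |]; rewrite Rabs_Ropp.
  specialize (Hb n Hn) as H1; specialize (Hb m Hm) as H2; lra.
Qed.

Lemma Ccv_of_geometric_increments (u : nat -> Cx) (C r : R) :
  (0 < r < 1)%R -> (forall n, (Cnorm (u (S n) - u n) <= C * r ^ n)%R) -> exists l, Ccv u l.
Proof.
  intros Hr Hu.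
  destruct (Un_cv_of_geometric_increments (fun n => fst (u n)) C r Hr) as [l1 H1].
  { intros n; eapply Rle_trans; [| apply Hu]; apply (Rabs_fst_le_Cnorm (u (S n) - u n)). }
  destruct (Un_cv_of_geometric_increments (fun n => snd (u n)) C r Hr) as [l2 H2].
  { intros n; eapply Rle_trans; [| apply Hu]; apply (Rabs_snd_le_Cnorm (u (S n) - u n)). }
  exists (l1, l2).
  apply (Ccv_le _ _ (fun n => Rabs (fst (u n) - l1) + Rabs (snd (u n) - l2))%R 0).
  - intros n _; apply (Cnorm_le_Rabs (u n - (l1, l2))).
  - rewrite <- (Rplus_0_r 0); apply CV_plus.
    + intros eps Heps; destruct (H1 eps Heps) as [K HK]; exists K; intros n Hn.
      specialize (HK n Hn); unfold Rdist in *; rewrite Rminus_0_r, Rabs_Rabsolu; exact HK.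
    + intros eps Heps; destruct (H2 eps Heps) as [K HK]; exists K; intros n Hn.
      specialize (HK n Hn); unfold Rdist in *; rewrite Rminus_0_r, Rabs_Rabsolu; exact HK.
Qed.

Lemma Rdiv_nonneg (x y : R) : (0 <= x)%R -> (0 < y)%R -> (0 <= x / y)%R.
Proof. intros; apply Rmult_le_pos; [assumption | apply Rlt_le, Rinv_0_lt_compat; assumption]. Qed.

(** Domination of this kind follows from a ratio test and serves twice: for summability and as the
    majorant in Tannery's theorem. *)
Definition geometric (u : nat -> Cx) : Prop :=
  exists C r, (0 < r < 1)%R /\ forall n, (Cnorm (u n) <= C * r ^ n)%R.

Lemma geometric_summable (u : nat -> Cx) : geometric u -> exists l, Ccv (Csum u) l.
Proof.
  intros [C [r [Hr Hu]]]; apply (Ccv_of_geometric_increments _ (C * r) r Hr).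
  intros n; simpl; replace (Csum u n + u (S n) - Csum u n) with (u (S n)) by ring.
  specialize (Hu (S n)); simpl in Hu; lra.
Qed.

Lemma geometric_shift (u : nat -> Cx) : geometric (fun n => u (S n)) -> geometric u.
Proof.
  intros [C [r [Hr Hu]]]; exists (Cnorm (u 0%nat) + C / r)%R, r; split; [exact Hr |].
  assert (HC : (0 <= C)%R) by (specialize (Hu 0%nat); pose proof (Cnorm_ge_0 (u 1%nat)); simpl in Hu; lra).
  assert (0 <= C / r)%R by (apply Rdiv_nonneg; lra).
  pose proof (Cnorm_ge_0 (u 0%nat)).
  intros [| n]; [simpl; lra |].
  eapply Rle_trans; [apply Hu |].
  assert (0 < r ^ n)%R by (apply pow_lt; lra).
  replace (C * r ^ n)%R with (C / r * r ^ S n)%R by (simpl; field; lra).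
  apply Rmult_le_compat_r; [apply pow_le; lra | lra].
Qed.

(** The ratio enters by multiplication, so [u] may vanish from some index on, as it does when a
    bilateral series terminates on one side. *)
Lemma geometric_of_ratio (u rho : nat -> Cx) (L : Cx) :
  (forall n, u (S n) = u n * rho n) -> Ccv rho L -> (Cnorm L < 1)%R -> geometric u.
Proof.
  intros Hu Hrho HL; pose proof (Cnorm_ge_0 L) as HL0.
  (* Half the gap to 1: from [K] on the ratio has modulus at most (1 + |L|)/2, which is positive
     even for L = 0. *)
  destruct (Hrho ((1 - Cnorm L) / 2)%R ltac:(lra)) as [K HK].
  assert (Htail : geometric (fun n => u (n + K)%nat)).
  { exists (Cnorm (u K)), ((1 + Cnorm L) / 2)%R; split; [lra |].
    induction n as [| n IH]; [simpl; lra |].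
    simpl; rewrite Hu, Cnorm_mul.
    specialize (HK (n + K)%nat ltac:(lia)).
    unfold Rdist in HK; rewrite Rminus_0_r, Rabs_pos_eq in HK by apply Cnorm_ge_0.
    pose proof (Cnorm_sub_ge (rho (n + K)%nat) L).
    rewrite (Rmult_comm ((1 + Cnorm L) / 2)), <- Rmult_assoc.
    apply Rmult_le_compat; try apply Cnorm_ge_0; [exact IH | lra]. }
  (* The [K] initial terms are put back one at a time, each at the cost of a larger constant. *)
  clear HK; revert Htail; induction K as [| K IH]; intros Htail.
  - destruct Htail as [C [r [Hr H]]]; exists C, r; split; [exact Hr |].
    intros n; specialize (H n); rewrite Nat.add_0_r in H; exact H.
  - apply IH, geometric_shift; destruct Htail as [C [r [Hr H]]]; exists C, r; split; [exact Hr |].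
    intros n; specialize (H n); rewrite Nat.add_succ_r in H; exact H.
Qed.

(** The part of the sum beyond K is at most C r^K/(1-r), uniformly in n and in the upper limit
    [s n]; what remains is a finite sum of null sequences. *)
Lemma tannery_R (h : nat -> nat -> R) (s : nat -> nat) (C r : R) :
  (0 < r < 1)%R -> (forall n k, (0 <= h n k <= C * r ^ k)%R) ->
  (forall k, Un_cv (fun n => h n k) 0) ->
  Un_cv (fun n => sum_f_R0 (h n) (s n)) 0.
Proof.
  intros Hr Hh Hcv.
  assert (HC : (0 <= C)%R) by (specialize (Hh 0%nat 0%nat); simpl in Hh; lra).
  assert (Htail : forall n K m, (sum_f_R0 (h n) m <= sum_f_R0 (h n) K + C * r ^ K / (1 - r))%R).
  { intros n K m.
    assert (HK0 : (0 <= C * r ^ K / (1 - r))%R).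
    { apply Rdiv_nonneg; [apply Rmult_le_pos; [exact HC | apply pow_le; lra] | lra]. }
    destruct (Nat.le_gt_cases m K) as [Hm | Hm].
    - assert (sum_f_R0 (h n) m <= sum_f_R0 (h n) K)%R; [| lra].
      induction Hm as [| K' Hm IH]; [lra |]; simpl; pose proof (Hh n (S K')).
      assert (0 <= C * r ^ K' / (1 - r))%R.
      { apply Rdiv_nonneg; [apply Rmult_le_pos; [exact HC | apply pow_le; lra] | lra]. }
      specialize (IH ltac:(assumption)); lra.
    - replace m with (K + (m - K))%nat by lia; generalize (m - K)%nat as k; intros k.
      apply Rle_trans with (sum_f_R0 (h n) K + C * (r ^ K - r ^ (K + k)) / (1 - r))%R.
      + induction k as [| k IH]; [rewrite Nat.add_0_r; right; field; lra |].
        rewrite Nat.add_succ_r; simpl sum_f_R0 at 1; pose proof (Hh n (S (K + k))) as H.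
        replace (C * (r ^ K - r ^ S (K + k)) / (1 - r))%R
          with (C * r ^ (K + k) + C * (r ^ K - r ^ (K + k)) / (1 - r))%R by (simpl; field; lra).
        assert (0 < r ^ (K + k))%R by (apply pow_lt; lra); simpl in H.
        assert (C * (r * r ^ (K + k)) <= C * r ^ (K + k))%R by (apply Rmult_le_compat_l; nra).
        lra.
      + apply Rplus_le_compat_l; unfold Rdiv; apply Rmult_le_compat_r;
          [apply Rlt_le, Rinv_0_lt_compat; lra |].
        assert (0 < r ^ (K + k))%R by (apply pow_lt; lra); nra. }
  assert (Hfin : forall K, Un_cv (fun n => sum_f_R0 (h n) K) 0).
  { induction K as [| K IH]; simpl; [apply Hcv |].
    rewrite <- (Rplus_0_r 0); apply CV_plus; [exact IH | apply Hcv]. }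
  intros eps Heps.
  destruct (pow_lt_1_zero r ltac:(rewrite Rabs_pos_eq; lra) (eps * (1 - r) / (2 * (C + 1)))%R) as [K HK].
  { apply Rdiv_lt_0_compat; nra. }
  specialize (HK K (Nat.le_refl K)); rewrite Rabs_pos_eq in HK by (apply pow_le; lra).
  destruct (Hfin K (eps / 2)%R ltac:(lra)) as [M HM]; exists M; intros n Hn.
  specialize (HM n Hn); unfold Rdist in *; rewrite Rminus_0_r in *.
  pose proof (Rle_abs (sum_f_R0 (h n) K)).
  rewrite Rabs_pos_eq by (apply cond_pos_sum; intros; apply Hh).
  eapply Rle_lt_trans; [apply (Htail n K) |].
  assert (C * r ^ K / (1 - r) < eps / 2)%R; [| lra].
  assert (0 < r ^ K)%R by (apply pow_lt; lra).
  apply Rmult_lt_reg_r with (1 - r)%R; [lra |].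
  replace (C * r ^ K / (1 - r) * (1 - r))%R with (C * r ^ K)%R by (field; lra).
  assert (r ^ K * (C + 1) < eps / 2 * (1 - r))%R; [| nra].
  replace (eps / 2 * (1 - r))%R with (eps * (1 - r) / (2 * (C + 1)) * (C + 1))%R by (field; lra).
  apply Rmult_lt_compat_r; lra.
Qed.

(** Splitting off W times the partial sum of [g] leaves the terms g k (w n k - W), which tend to 0
    for each k and are dominated by C (D + |W|) r^k. *)
Lemma tannery (g : nat -> Cx) (w : nat -> nat -> Cx) (S1 W : Cx) (D : R) (s : nat -> nat) (K : nat) :
  geometric g -> (forall n k, (Cnorm (w n k) <= D)%R) -> (forall k, Ccv (fun n => w n k) W) ->
  (forall n, (n <= s (n + K))%nat) -> Ccv (Csum g) S1 ->
  Ccv (fun n => Csum (fun k => g k * w n k) (s n)) (W * S1).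
Proof.
  intros [C [r [Hr Hg]]] Hw Hcv Hs HS1.
  assert (HC : (0 <= C)%R) by (specialize (Hg 0%nat); pose proof (Cnorm_ge_0 (g 0%nat)); simpl in Hg; lra).
  apply Ccv_ext with
    (fun n => Csum (fun k => g k * w n k - W * g k) (s n) + W * Csum g (s n)).
  { intros n; rewrite <- Csum_sub_scal; ring. }
  replace (W * S1) with (Czero + W * S1) by ring.
  apply Ccv_add; [| apply Ccv_mul; [apply Ccv_const | apply Ccv_subseq with K; assumption]].
  apply (Ccv_le _ _ (fun n => sum_f_R0 (fun k => Cnorm (g k * w n k - W * g k)) (s n)) 0).
  { intros n _; replace (Csum (fun k => g k * w n k - W * g k) (s n) - Czero)
      with (Csum (fun k => g k * w n k - W * g k) (s n)) by ring; apply Cnorm_Csum. }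
  apply (tannery_R (fun n k => Cnorm (g k * w n k - W * g k)) s (C * (D + Cnorm W)) r Hr).
  - intros n k; split; [apply Cnorm_ge_0 |].
    replace (g k * w n k - W * g k) with (g k * (w n k - W)) by ring.
    rewrite Cnorm_mul, Rmult_assoc, (Rmult_comm _ (r ^ k)), <- Rmult_assoc.
    apply Rmult_le_compat; try apply Cnorm_ge_0; [apply Hg |].
    eapply Rle_trans; [apply Cnorm_sub |]; specialize (Hw n k); lra.
  - intros k; assert (H : Ccv (fun n => g k * w n k) (g k * W)) by (apply Ccv_mul; [apply Ccv_const | apply Hcv]).
    intros eps Heps; destruct (H eps Heps) as [M HM]; exists M; intros n Hn.
    replace (W * g k) with (g k * W) by ring; apply HM, Hn.
Qed.

(** * q-shifted factorials *)

Lemma Cpow_add (u : Cx) (n m : nat) : Cpow u (n + m) = Cpow u n * Cpow u m.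
Proof. induction n as [| n IH]; simpl; [ring | rewrite IH; ring]. Qed.

Lemma Cpow_mul (u v : Cx) (n : nat) : Cpow (u * v) n = Cpow u n * Cpow v n.
Proof. induction n as [| n IH]; simpl; [ring | rewrite IH; ring]. Qed.

Lemma Cpow_neq_0 (u : Cx) (n : nat) : u <> Czero -> Cpow u n <> Czero.
Proof.
  intros H; induction n as [| n IH]; simpl; [apply Cone_neq_0 | apply Cmul_neq_0; assumption].
Qed.

Lemma Cnorm_Cpow (u : Cx) (n : nat) : Cnorm (Cpow u n) = (Cnorm u ^ n)%R.
Proof. induction n as [| n IH]; simpl; [apply Cnorm_1 | rewrite Cnorm_mul, IH; ring]. Qed.

Lemma Ccv_Cpow_0 (u : Cx) : (Cnorm u < 1)%R -> Ccv (Cpow u) Czero.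
Proof.
  intros H eps Heps; pose proof (Cnorm_ge_0 u).
  destruct (pow_lt_1_zero (Cnorm u) ltac:(rewrite Rabs_pos_eq; lra) eps Heps) as [K HK].
  exists K; intros n Hn; specialize (HK n Hn); unfold Rdist; rewrite Rminus_0_r.
  replace (Cpow u n - Czero) with (Cpow u n) by ring.
  rewrite Cnorm_Cpow, (Rabs_pos_eq (Cnorm u ^ n)) by (apply pow_le; lra).
  rewrite Rabs_pos_eq in HK by (apply pow_le; lra); exact HK.
Qed.

Lemma qpoch_first (x p : Cx) (n : nat) : qpoch x p (S n) = (Cone - x) * qpoch (x * p) p n.
Proof.
  induction n as [| n IH]; [simpl; ring |].
  change (qpoch x p (S (S n))) with (qpoch x p (S n) * (Cone - x * Cpow p (S n))).
  rewrite IH; simpl; ring.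
Qed.

Lemma qpoch_add (x p : Cx) (n m : nat) :
  qpoch x p (n + m) = qpoch x p n * qpoch (x * Cpow p n) p m.
Proof.
  induction m as [| m IH]; [rewrite Nat.add_0_r; simpl; ring |].
  rewrite Nat.add_succ_r; simpl; rewrite IH, Cpow_add; ring.
Qed.

Lemma qpoch_neq_0 (x p : Cx) (n : nat) :
  (forall k, (k < n)%nat -> Cone - x * Cpow p k <> Czero) -> qpoch x p n <> Czero.
Proof.
  induction n as [| n IH]; intros H; simpl; [apply Cone_neq_0 |].
  apply Cmul_neq_0; [apply IH; intros; apply H; lia | apply H; lia].
Qed.

Lemma qpoch_factor_neq_0 (x p : Cx) :
  (forall n, qpoch x p n <> Czero) -> forall n, Cone - x * Cpow p n <> Czero.
Proof. intros H n; exact (proj2 (Cmul_neq_0_inv _ _ (H (S n)))). Qed.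

(** By 1 + x <= exp x the partial products stay below a multiple of exp (c/(1-r)), so the increments
    [u n * e n] decay geometrically. *)
Lemma infinite_product_cv (u e : nat -> Cx) (c r : R) :
  (0 <= c)%R -> (0 < r < 1)%R -> (forall n, u (S n) = u n * (Cone + e n)) ->
  (forall n, (Cnorm (e n) <= c * r ^ n)%R) -> exists l, Ccv u l.
Proof.
  intros Hc Hr Hu He.
  assert (Hb : forall n, (Cnorm (u n) <= Cnorm (u 0%nat) * exp (c * (1 - r ^ n) / (1 - r)))%R).
  { induction n as [| n IH].
    - simpl; replace (c * (1 - 1) / (1 - r))%R with 0%R by (field; lra); rewrite exp_0; lra.
    - rewrite Hu, Cnorm_mul.
      replace (c * (1 - r ^ S n) / (1 - r))%R
        with (c * (1 - r ^ n) / (1 - r) + c * r ^ n)%R by (simpl; field; lra).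
      rewrite exp_plus, <- Rmult_assoc; apply Rmult_le_compat; try apply Cnorm_ge_0; [exact IH |].
      eapply Rle_trans; [apply Cnorm_add | rewrite Cnorm_1].
      eapply Rle_trans; [| apply exp_ineq1_le]; specialize (He n); lra. }
  apply (Ccv_of_geometric_increments u (Cnorm (u 0%nat) * exp (c / (1 - r)) * c) r Hr).
  intros n; rewrite Hu; replace (u n * (Cone + e n) - u n) with (u n * e n) by ring.
  rewrite Cnorm_mul, Rmult_assoc; apply Rmult_le_compat; try apply Cnorm_ge_0; [| apply He].
  eapply Rle_trans; [apply Hb |]; apply Rmult_le_compat_l; [apply Cnorm_ge_0 |].
  assert (Hle : (c * (1 - r ^ n) / (1 - r) <= c / (1 - r))%R).
  { apply Rmult_le_compat_r; [apply Rlt_le, Rinv_0_lt_compat; lra |].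
    assert (0 < r ^ n)%R by (apply pow_lt; lra); nra. }
  destruct Hle as [Hlt | ->]; [apply Rlt_le, exp_increasing, Hlt | lra].
Qed.

(** Since [qinf] is an epsilon-choice of a limit, [epsilon_spec] reduces the claim to the existence
    of some limit. *)
Lemma qpoch_cv (x p : Cx) : p <> Czero -> (Cnorm p < 1)%R -> Ccv (qpoch x p) (qinf x p).
Proof.
  intros Hp0 Hp; unfold qinf, Clim; apply epsilon_spec.
  apply (infinite_product_cv _ (fun n => - (x * Cpow p n)) (Cnorm x) (Cnorm p)).
  - apply Cnorm_ge_0.
  - split; [apply Cnorm_gt_0, Hp0 | exact Hp].
  - intros n; simpl; ring.
  - intros n; rewrite Cnorm_opp, Cnorm_mul, Cnorm_Cpow; lra.
Qed.

(** A vanishing partial product makes all later ones vanish, hence also the limit. In this way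
    hypotheses on infinite products reach the finite identities. *)
Lemma qpoch_neq_0_of_qinf (x p : Cx) (n : nat) :
  p <> Czero -> (Cnorm p < 1)%R -> qinf x p <> Czero -> qpoch x p n <> Czero.
Proof.
  intros Hp0 Hp Hx H; apply Hx.
  assert (Hz : forall m, qpoch x p (m + n) = Czero).
  { intros m; rewrite Nat.add_comm, qpoch_add, H; ring. }
  apply (Ccv_unique (fun m => qpoch x p (m + n))).
  - apply (Ccv_subseq (qpoch x p) _ (fun m => (m + n)%nat) 0); [intros; lia | apply qpoch_cv; assumption].
  - apply Ccv_ext with (fun _ => Czero); [intros; rewrite Hz; reflexivity | apply Ccv_const].
Qed.

(* The reciprocals of the partial products converge too, since
   1/(1 - x p^n) = 1 + x p^n/(1 - x p^n) with a denominator of modulus at least 1 - |x|. *)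
Lemma qinf_neq_0 (x p : Cx) :
  p <> Czero -> (Cnorm p < 1)%R -> (Cnorm x < 1)%R -> qinf x p <> Czero.
Proof.
  intros Hp0 Hp Hx H.
  pose proof (Cnorm_ge_0 x); pose proof (Cnorm_gt_0 p Hp0).
  assert (Hpow : forall n, (Cnorm (x * Cpow p n) <= Cnorm x)%R).
  { intros n; rewrite Cnorm_mul, Cnorm_Cpow.
    assert (Cnorm p ^ n <= 1)%R; [| nra].
    rewrite <- (pow1 n); apply pow_incr; lra. }
  assert (Hfac : forall n, (1 - Cnorm x <= Cnorm (Cone - x * Cpow p n)%Cx)%R).
  { intros n; specialize (Hpow n); pose proof (Cnorm_sub_ge Cone (x * Cpow p n)) as E.
    rewrite Cnorm_1 in E; lra. }
  assert (Hf0 : forall n, Cone - x * Cpow p n <> Czero).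
  { intros n E; specialize (Hfac n); rewrite E, Cnorm_0 in Hfac; lra. }
  assert (Hq0 : forall n, qpoch x p n <> Czero) by (intros; apply qpoch_neq_0; intros; apply Hf0).
  destruct (infinite_product_cv (fun n => Cinv (qpoch x p n))
              (fun n => x * Cpow p n / (Cone - x * Cpow p n))
              (Cnorm x / (1 - Cnorm x))%R (Cnorm p)) as [l Hl].
  - apply Rdiv_nonneg; lra.
  - lra.
  - intros n; simpl; field; split; [apply Hf0 | apply Hq0].
  - intros n; unfold Cdiv; rewrite Cnorm_mul, (Cnorm_inv _ (Hf0 n)), Cnorm_mul, Cnorm_Cpow.
    specialize (Hfac n); unfold Rdiv.
    rewrite Rmult_assoc, (Rmult_comm (_ ^ n)), <- Rmult_assoc.
    apply Rmult_le_compat_r; [apply pow_le; lra |].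
    apply Rmult_le_compat_l; [lra | apply Rinv_le_contravar; lra].
  - apply Cone_neq_0.
    apply (Ccv_unique (fun n => qpoch x p n * Cinv (qpoch x p n))).
    + apply Ccv_ext with (fun _ => Cone); [intros n; field; apply Hq0 | apply Ccv_const].
    + replace Czero with (qinf x p * l) by (rewrite H; ring).
      apply Ccv_mul; [apply qpoch_cv; assumption | exact Hl].
Qed.

(** * Sums over antidiagonals and terminating transformations *)

(** Summing over pairs with i + j = n avoids truncated subtraction and turns the exchange of double
    sums into associativity. *)
Fixpoint asum (F : nat -> nat -> Cx) (n : nat) : Cx :=
  match n with
  | O => F O O
  | S m => F O (S m) + asum (fun i j => F (S i) j) m
  end.

Lemma asum_ext (n : nat) : forall F G : nat -> nat -> Cx,
  (forall i j, (i + j)%nat = n -> F i j = G i j) -> asum F n = asum G n.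
Proof.
  induction n as [| n IH]; intros F G H; simpl; [apply H; reflexivity |].
  rewrite (H 0%nat (S n)) by reflexivity; f_equal.
  apply IH; intros i j E; apply H; lia.
Qed.

Lemma asum_last (n : nat) : forall F : nat -> nat -> Cx,
  asum F (S n) = asum (fun i j => F i (S j)) n + F (S n) O.
Proof.
  induction n as [| n IH]; intros F; [reflexivity |].
  change (asum F (S (S n))) with (F O (S (S n)) + asum (fun i j => F (S i) j) (S n)).
  rewrite IH; simpl; ring.
Qed.

Lemma asum_add (n : nat) : forall F G : nat -> nat -> Cx,
  asum (fun i j => F i j + G i j) n = asum F n + asum G n.
Proof. induction n as [| n IH]; intros F G; simpl; [ring | rewrite IH; ring]. Qed.

Lemma asum_scal (c : Cx) (n : nat) : forall F : nat -> nat -> Cx,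
  asum (fun i j => c * F i j) n = c * asum F n.
Proof. induction n as [| n IH]; intros F; simpl; [ring | rewrite IH; ring]. Qed.

(** This is the exchange of summation behind the 3phi2 and Watson transformations: both sides run
    over the triples with k + l + j = n. *)
Lemma asum_assoc (n : nat) : forall T : nat -> nat -> nat -> Cx,
  asum (fun i j => asum (fun k l => T k l j) i) n
  = asum (fun k m => asum (fun l j => T k l j) m) n.
Proof.
  induction n as [| n IH]; intros T; [reflexivity |].
  simpl; rewrite <- (IH (fun k l j => T (S k) l j)).
  rewrite (asum_add n (fun i j => T O (S i) j)).
  apply (Radd_assoc Cx_ring_theory).
Qed.

(** The induction step for sums weighted by Gaussian binomials: Pascal's rule splits an interior
    term into a part with j lowered and a part with i lowered, and at each end of the antidiagonal
    only one part survives. *)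
Lemma asum_pascal (F G H : nat -> nat -> Cx) (n : nat) :
  H O (S n) = F O n -> H (S n) O = G n O ->
  (forall i j, S (i + j) = n -> H (S i) (S j) = F (S i) j + G i (S j)) ->
  asum H (S n) = asum F n + asum G n.
Proof.
  intros H0 H1 H2.
  (* Padding with zero on the missing edge lets both lowered sums run over the antidiagonal of S
     n. *)
  set (F' := fun i j => match j with O => Czero | S j' => F i j' end).
  set (G' := fun i j => match i with O => Czero | S i' => G i' j end).
  transitivity (asum (fun i j => F' i j + G' i j) (S n)).
  - apply asum_ext; intros [| i] [| j] E; unfold F', G'; try lia.
    + simpl in E; injection E as ->; rewrite H0; simpl; ring.
    + rewrite Nat.add_0_r in E; injection E as ->; rewrite H1; simpl; ring.
    + apply H2; lia.
  - rewrite asum_add, asum_last; unfold F', G'; simpl.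
    transitivity (asum F n + Czero + (Czero + asum G n)); [reflexivity | ring].
Qed.

Lemma asum_Csum (n : nat) : forall F : nat -> nat -> Cx,
  asum F n = Csum (fun i => F i (n - i)%nat) n.
Proof.
  induction n as [| n IH]; intros F; [reflexivity |].
  rewrite asum_last, IH; cbn [Csum]; rewrite Nat.sub_diag; f_equal.
  apply Csum_ext_le; intros k Hk; f_equal; lia.
Qed.

(* tri p n = p^(n(n-1)/2) *)
Fixpoint tri (p : Cx) (n : nat) : Cx :=
  match n with O => Cone | S m => tri p m * Cpow p m end.

Lemma tri_neq_0 (p : Cx) (n : nat) : p <> Czero -> tri p n <> Czero.
Proof.
  intros H; induction n as [| n IH]; simpl; [apply Cone_neq_0 |].
  apply Cmul_neq_0; [exact IH | apply Cpow_neq_0, H].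
Qed.

Lemma Cpow_pow_S (p : Cx) (n m : nat) : Cpow (Cpow p (S n)) m = Cpow (Cpow p n) m * Cpow p m.
Proof. simpl; apply Cpow_mul. Qed.

Lemma tri_add (p : Cx) (n m : nat) : tri p (n + m) = tri p n * tri p m * Cpow (Cpow p n) m.
Proof.
  induction m as [| m IH]; [rewrite Nat.add_0_r; simpl; ring |].
  rewrite Nat.add_succ_r; simpl; rewrite IH, Cpow_add; ring.
Qed.

(** Evaluates p^(N^2), which appears in central terms when p^-N is raised to the power N. *)
Lemma Cpow_square (p : Cx) (n : nat) : Cpow (Cpow p n) n = tri p n * tri p n * Cpow p n.
Proof.
  induction n as [| n IH]; [simpl; ring |].
  rewrite Cpow_pow_S; simpl; rewrite IH; ring.
Qed.

(** * Gaussian binomials, q-Vandermonde sums and 3phi2 transformations *)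

Definition qbin (p : Cx) (i j : nat) : Cx := qpoch p p (i + j) / (qpoch p p i * qpoch p p j).

Lemma qbin_S_l (p : Cx) (i j : nat) :
  (forall n, qpoch p p n <> Czero) ->
  qbin p i (S j) = qbin p i j * (Cone - p * (Cpow p i * Cpow p j)) / (Cone - p * Cpow p j).
Proof.
  intros Hp; pose proof (qpoch_factor_neq_0 p p Hp j) as Hj; pose proof (Hp i); pose proof (Hp j).
  unfold qbin; rewrite Nat.add_succ_r; simpl; rewrite Cpow_add; field; auto.
Qed.

Lemma qbin_S_r (p : Cx) (i j : nat) :
  (forall n, qpoch p p n <> Czero) ->
  qbin p (S i) j = qbin p i j * (Cone - p * (Cpow p i * Cpow p j)) / (Cone - p * Cpow p i).
Proof.
  intros Hp; pose proof (qpoch_factor_neq_0 p p Hp i) as Hi; pose proof (Hp i); pose proof (Hp j).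
  unfold qbin; simpl; rewrite Cpow_add; field; auto.
Qed.

Lemma qbin_0_l (p : Cx) (n : nat) : (forall n, qpoch p p n <> Czero) -> qbin p O n = Cone.
Proof. intros Hp; unfold qbin; simpl; field; apply Hp. Qed.

Lemma qbin_0_r (p : Cx) (n : nat) : (forall n, qpoch p p n <> Czero) -> qbin p n O = Cone.
Proof.
  intros Hp; unfold qbin; rewrite Nat.add_0_r; simpl; field; apply Hp.
Qed.

Lemma qbin_pascal (p : Cx) (i j : nat) :
  (forall n, qpoch p p n <> Czero) ->
  qbin p (S i) (S j) = qbin p (S i) j + Cpow p (S j) * qbin p i (S j).
Proof.
  intros Hp; pose proof (qpoch_factor_neq_0 p p Hp i) as Hi; pose proof (qpoch_factor_neq_0 p p Hp j) as Hj.
  rewrite (qbin_S_l p (S i) j), (qbin_S_l p i j), !(qbin_S_r p i j) by assumption.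
  simpl; field; auto.
Qed.

(** Both products are the q-trinomial coefficient of k, l, j, so the binomials can follow the
    regrouping of a triple sum. *)
Lemma qbin_trinomial (p : Cx) (k l j : nat) :
  (forall n, qpoch p p n <> Czero) ->
  qbin p (k + l) j * qbin p k l = qbin p k (l + j) * qbin p l j.
Proof.
  intros Hp; unfold qbin; rewrite Nat.add_assoc; field; repeat split; apply Hp.
Qed.

(** The q-Chu-Vandermonde sum of 2phi1(p^-n, x; p^(1-n)/y; p, p), cleared of denominators. *)
Lemma q_vandermonde (p x y : Cx) (n : nat) :
  (forall n, qpoch p p n <> Czero) ->
  asum (fun i j => qbin p i j * (qpoch x p i * qpoch y p j * Cpow y i)) n = qpoch (x * y) p n.
Proof.
  intros Hp; induction n as [| n IH]; [simpl; rewrite qbin_0_l by assumption; ring |].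
  set (H := fun i j => qbin p i j * (qpoch x p i * qpoch y p j * Cpow y i)) in *.
  (* On i + j = n the coefficients of the two parts add up to 1 - x y p^n, the last factor of
     (xy;p)_(n+1). *)
  rewrite (asum_pascal (fun i j => (Cone - y * Cpow p j) * H i j)
             (fun i j => y * Cpow p j * (Cone - x * Cpow p i) * H i j)); unfold H.
  - rewrite <- asum_add.
    rewrite (asum_ext n _ (fun i j => (Cone - x * y * Cpow p n) * H i j)).
    + rewrite asum_scal, IH; simpl; ring.
    + intros i j <-; rewrite Cpow_add; unfold H; ring.
  - rewrite !qbin_0_l by assumption; simpl; ring.
  - rewrite !qbin_0_r by assumption; simpl; ring.
  - intros i j _; rewrite qbin_pascal by assumption; simpl; ring.
Qed.

(** The other q-Chu-Vandermonde sum, of 2phi1(p^-n, w; w y; p, y p^n). The Pascal step replaces w by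
    w p, so w is quantified inside the induction; as the value is free of w, the two parts combine
    through (1 - w y p^n) - y p^n (1 - w) = 1 - y p^n. *)
Lemma q_vandermonde_inverse (p y : Cx) (n : nat) :
  (forall n, qpoch p p n <> Czero) -> forall w,
  asum (fun i j => qbin p i j *
          (Cpow (- y) i * tri p i * qpoch w p i * qpoch (w * y * Cpow p i) p j)) n = qpoch y p n.
Proof.
  intros Hp; induction n as [| n IH]; intros w; [simpl; rewrite qbin_0_l by assumption; ring |].
  set (H := fun w i j => qbin p i j *
          (Cpow (- y) i * tri p i * qpoch w p i * qpoch (w * y * Cpow p i) p j)) in *.
  change (asum (H w) (S n) = qpoch y p (S n)).
  rewrite (asum_pascal (fun i j => (Cone - w * y * Cpow p i * Cpow p j) * H w i j)
             (fun i j => - y * (Cpow p i * Cpow p j) * (Cone - w) * H (w * p) i j)).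
  - rewrite (asum_ext n (fun i j => _ * H w i j) (fun i j => (Cone - w * y * Cpow p n) * H w i j))
      by (intros i j <-; rewrite Cpow_add; ring).
    rewrite (asum_ext n (fun i j => _ * H (w * p) i j)
               (fun i j => (- y * Cpow p n * (Cone - w)) * H (w * p) i j))
      by (intros i j <-; rewrite Cpow_add; ring).
    rewrite !asum_scal; unfold H; rewrite !IH; simpl; ring.
  - unfold H; rewrite !qbin_0_l by assumption; simpl; ring.
  - unfold H; rewrite !qbin_0_r by assumption; rewrite qpoch_first; simpl; ring.
  - intros i j _; unfold H; rewrite qbin_pascal by assumption.
    rewrite (qpoch_first w p i).
    replace (w * p * y * Cpow p i) with (w * y * Cpow p (S i)) by (simpl; ring).
    simpl; ring.
Qed.

(* Terminating 3phi2 series in which the numerator parameter p^-n is absorbed into the Gaussian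
   binomial: phiX is 3phi2(p^-n, al, w; be, de; p, be de p^n/(al w)), and phiY is
   (t;p)_n 3phi2(p^-n, x, y; s, p^(1-n)/t; p, p). *)
Definition phiX (p al w be de : Cx) (n : nat) : Cx :=
  asum (fun i j => qbin p i j *
    (qpoch al p i * qpoch w p i / (qpoch be p i * qpoch de p i)
     * (Cpow (- (be * de / (al * w))) i * tri p i))) n.

Definition phiY (p x y s t : Cx) (n : nat) : Cx :=
  asum (fun i j => qbin p i j *
    (qpoch x p i * qpoch y p i / qpoch s p i * qpoch t p j * Cpow t i)) n.

Lemma phiX_sym (p al w be de : Cx) (n : nat) : phiX p al w be de n = phiX p al w de be n.
Proof.
  unfold phiX; apply asum_ext; intros i j _.
  replace (de * be) with (be * de) by ring.
  replace (qpoch de p i * qpoch be p i) with (qpoch be p i * qpoch de p i) by ring; reflexivity.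
Qed.

Lemma phiY_sym (p x y s t : Cx) (n : nat) : phiY p x y s t n = phiY p y x s t n.
Proof.
  unfold phiY; apply asum_ext; intros i j _.
  replace (qpoch x p i * qpoch y p i) with (qpoch y p i * qpoch x p i) by ring; reflexivity.
Qed.

(* Gasper and Rahman (III.13): expand (de/w)_i/(de)_i by the q-Vandermonde sum and exchange
   the order of summation. *)
Lemma phiX_phiY (p al w be de : Cx) (n : nat) :
  (forall n, qpoch p p n <> Czero) -> al <> Czero -> w <> Czero ->
  (forall n, qpoch be p n <> Czero) -> (forall n, qpoch de p n <> Czero) ->
  qpoch be p n * phiX p al w be de n = phiY p al (de / w) de (be / al) n.
Proof.
  intros Hp Hal Hw Hbe Hde.
  (* Here k is the index of [phiX] and k + l that of [phiY]: fixing k leaves [q_vandermonde] in l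
     and j, fixing k + l leaves [q_vandermonde_inverse] in k and l. *)
  set (T := fun k l j => qbin p (k + l) j * qbin p k l *
     (qpoch al p (k + l) * qpoch (be / al) p j * Cpow (be / al) (k + l)
      * (Cpow (- (de / w)) k * tri p k * qpoch w p k / qpoch de p k))).
  transitivity (asum (fun i j => asum (fun k l => T k l j) i) n).
  - rewrite asum_assoc; unfold phiX; rewrite <- asum_scal; apply asum_ext; intros k m <-.
    rewrite (asum_ext m _ (fun l j => (qbin p k m * (qpoch al p k * Cpow (be / al) k
        * (Cpow (- (de / w)) k * tri p k * qpoch w p k / qpoch de p k)))
        * (qbin p l j * (qpoch (al * Cpow p k) p l * qpoch (be / al) p j * Cpow (be / al) l)))).
    + rewrite asum_scal, q_vandermonde by assumption.
      replace (al * Cpow p k * (be / al)) with (be * Cpow p k) by (field; assumption).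
      replace (- (be * de / (al * w))) with ((be / al) * (- (de / w))) by (field; auto).
      rewrite Cpow_mul, qpoch_add; pose proof (Hbe k); pose proof (Hde k); field; auto.
    + intros l j <-; unfold T; rewrite qbin_trinomial, qpoch_add, Cpow_add by assumption.
      unfold Cdiv; ring.
  - unfold phiY; apply asum_ext; intros i j _.
    rewrite <- (q_vandermonde_inverse p (de / w) i Hp w).
    rewrite (asum_ext i _ (fun k l => (qbin p i j * (qpoch al p i / qpoch de p i * qpoch (be / al) p j
       * Cpow (be / al) i)) * (qbin p k l * (Cpow (- (de / w)) k * tri p k * qpoch w p k
       * qpoch (w * (de / w) * Cpow p k) p l)))).
    + rewrite asum_scal; unfold Cdiv; ring.
    + intros k l <-; unfold T.
      replace (w * (de / w)) with de by (field; assumption).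
      pose proof (Hde k) as Hk; pose proof (Hde (k + l)%nat) as Hkl; rewrite (qpoch_add de) in *.
      destruct (Cmul_neq_0_inv _ _ Hkl); field; auto.
Qed.

(** Three uses of [phiX_phiY]: [phiY] is symmetric in its two numerator parameters, so two different
    [phiX] series lead to the same [phiY]. Equating them gives [E1], and transforming the second
    [phiX] once more gives the claim. *)
Lemma phiX_phiY_reversed (p al w be de : Cx) (n : nat) :
  (forall n, qpoch p p n <> Czero) -> al <> Czero -> w <> Czero -> be <> Czero -> de <> Czero ->
  (forall n, qpoch be p n <> Czero) -> (forall n, qpoch de p n <> Czero) ->
  (forall n, qpoch (be * de / (al * w)) p n <> Czero) ->
  qpoch be p n * qpoch de p n * phiX p al w be de n
  = qpoch (be * de / (al * w)) p n * phiY p (be / w) (de / w) (be * de / (al * w)) w n.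
Proof.
  intros Hp Hal Hw Hbe0 Hde0 Hbe Hde He.
  set (e := be * de / (al * w)) in *.
  assert (E1 : qpoch de p n * phiX p al w be de n
               = qpoch e p n * phiX p (be / w) (be / al) be e n).
  { rewrite phiX_sym, phiX_phiY by assumption.
    rewrite (phiX_sym p (be / w)), phiX_phiY by (try apply Cdiv_neq_0; assumption).
    replace (be / (be / al)) with al by (field; auto).
    replace (e / (be / w)) with (de / al) by (unfold e; field; auto).
    apply phiY_sym. }
  transitivity (qpoch be p n * (qpoch de p n * phiX p al w be de n)); [ring | rewrite E1].
  transitivity (qpoch e p n * (qpoch be p n * phiX p (be / w) (be / al) be e n)); [ring |].
  rewrite phiX_phiY by (try apply Cdiv_neq_0; assumption).
  replace (e / (be / al)) with (de / w) by (unfold e; field; auto).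
  replace (be / (be / w)) with w by (field; auto).
  reflexivity.
Qed.

(** * The q-Saalschuetz sum and Watson's transformation *)

Lemma tri_S (p : Cx) (n : nat) : tri p (S n) = tri p n * Cpow p n.
Proof. reflexivity. Qed.

Lemma qpoch_shift_first (x p : Cx) (i j : nat) :
  qpoch (x * Cpow p i) p (S j) = (Cone - x * Cpow p i) * qpoch (x * Cpow p (S i)) p j.
Proof.
  rewrite qpoch_first; replace (x * Cpow p i * p) with (x * Cpow p (S i)) by (simpl; ring).
  reflexivity.
Qed.

(* q-Saalschuetz, multiplied by p^(n(n-1)/2) so that only nonnegative powers of p occur; B stands
   for the numerator parameter A p^n, which the balancing condition determines. *)
Lemma q_saalschuetz (p : Cx) (n : nat) :
  p <> Czero -> (forall n, qpoch p p n <> Czero) -> forall w b d B,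
  B * p = w * b * d * Cpow p n ->
  asum (fun i j => qbin p i j *
          (Cpow (- Cone) i * tri p j * qpoch w p i * qpoch B p i
           * qpoch (w * b * Cpow p i) p j * qpoch (w * d * Cpow p i) p j)) n
  = tri p n * Cpow w n * qpoch b p n * qpoch d p n.
Proof.
  intros Hp0 Hp; induction n as [| n IH]; intros w b d B HB.
  { simpl; rewrite qbin_0_l by assumption; ring. }
  assert (HB' : B = w * b * d * Cpow p n).
  { apply (Cmul_cancel_l p); [exact Hp0 |].
    replace (p * B) with (B * p) by ring; rewrite HB; simpl; ring. }
  set (H := fun w b d B i j => qbin p i j *
          (Cpow (- Cone) i * tri p j * qpoch w p i * qpoch B p i
           * qpoch (w * b * Cpow p i) p j * qpoch (w * d * Cpow p i) p j)) in *.
  change (asum (H w b d B) (S n) = tri p (S n) * Cpow w (S n) * qpoch b p (S n) * qpoch d p (S n)).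
  (* Both parts stay balanced: the first keeps B and turns d into d p, the second turns w, d, B into
     w p, d p, B p. They combine through (1 - w b p^n)(1 - w d) - (1 - w)(1 - B) = w (1 - d)(1 - b
     p^n). *)
  rewrite (asum_pascal
    (fun i j => Cpow p n * (Cone - w * b * Cpow p n) * (Cone - w * d) * H w b (d * p) B i j)
    (fun i j => - ((Cone - w) * (Cone - B)) * H (w * p) b (d * p) (B * p) i j)).
  - rewrite !asum_scal; unfold H; rewrite !IH.
    + rewrite (qpoch_first d), HB', Cpow_mul; simpl; ring.
    + rewrite HB'; ring.
    + rewrite HB'; ring.
  - unfold H; rewrite !qbin_0_l by assumption.
    replace (w * (d * p) * Cpow p 0) with (w * d * Cpow p 0 * p) by ring.
    rewrite (qpoch_first (w * d * Cpow p 0)); simpl.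
    replace (w * b * Cone) with (w * b) by ring; ring.
  - unfold H; rewrite !qbin_0_r by assumption.
    rewrite (qpoch_first w p n), (qpoch_first B p n); simpl; ring.
  - intros i j <-; unfold H; rewrite (qpoch_first w p i), (qpoch_first B p i).
    replace (w * (d * p) * Cpow p (S i)) with (w * d * Cpow p (S (S i))) by (simpl; ring).
    replace (w * p * b * Cpow p i) with (w * b * Cpow p (S i)) by (simpl; ring).
    replace (w * p * (d * p) * Cpow p i) with (w * d * Cpow p (S (S i))) by (simpl; ring).
    rewrite (qpoch_shift_first (w * d) p (S i)).
    pose proof (qpoch_factor_neq_0 p p Hp i) as Hi; pose proof (qpoch_factor_neq_0 p p Hp j) as Hj.
    rewrite (qbin_S_l p (S i) j), (qbin_S_l p i j), !(qbin_S_r p i j) by assumption.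
    rewrite tri_S; cbn [qpoch Cpow]; rewrite Cpow_add; field; auto.
Qed.

(* The terminating very-well-poised 6phi5 sum with one parameter sent to infinity. *)
Lemma vwp_sum (p : Cx) (n : nat) :
  (forall n, qpoch p p n <> Czero) -> forall A al y,
  al * y = A * p -> (forall m, Cone - A * Cpow p m <> Czero) ->
  asum (fun i j => qbin p i j *
          ((Cone - A * Cpow p i * Cpow p i) * qpoch al p i * Cpow y i * tri p i * tri p i
           * qpoch (y * Cpow p i) p j / qpoch (A * Cpow p i) p (S (i + j)))) n
  = Cone.
Proof.
  intros Hp; induction n as [| n IH]; intros A al y Hy HA.
  { simpl; rewrite qbin_0_l by assumption; specialize (HA 0%nat); simpl in HA.
    replace (A * Cone) with A in HA by ring; field; exact HA. }
  set (H := fun A al y i j => qbin p i j *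
          ((Cone - A * Cpow p i * Cpow p i) * qpoch al p i * Cpow y i * tri p i * tri p i
           * qpoch (y * Cpow p i) p j / qpoch (A * Cpow p i) p (S (i + j)))) in *.
  change (asum (H A al y) (S n) = Cone).
  set (den := Cone - A * Cpow p (S n)).
  assert (Hden : den <> Czero) by apply HA.
  assert (HA2 : forall m, Cone - A * (p * p) * Cpow p m <> Czero).
  { intros m E; apply (HA (S (S m))); rewrite <- E; simpl; ring. }
  assert (Hq : forall i m, qpoch (A * Cpow p i) p m <> Czero).
  { intros i m; apply qpoch_neq_0; intros k _ E; apply (HA (i + k)%nat).
    rewrite <- E, Cpow_add; ring. }
  (* The second part belongs to A p^2, al p, y p, which again satisfy al y = A p. By induction both
     sums are 1, and the coefficients add up to (1 - al y p^n)/den = 1. *)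
  rewrite (asum_pascal
    (fun i j => (Cone - y * Cpow p n) / den * H A al y i j)
    (fun i j => Cpow p n * y * (Cone - al) / den * H (A * (p * p)) (al * p) (y * p) i j)).
  - rewrite !asum_scal; unfold H; rewrite !IH.
    + assert (E : den = Cone - al * y * Cpow p n) by (unfold den; rewrite Hy; simpl; ring).
      transitivity ((Cone - al * y * Cpow p n) / den); [field; exact Hden |].
      rewrite <- E; field; exact Hden.
    + replace (al * p * (y * p)) with (al * y * p * p) by ring; rewrite Hy; ring.
    + exact HA2.
    + exact Hy.
    + exact HA.
  - unfold H; rewrite !qbin_0_l by assumption; simpl.
    replace (A * Cone) with A by ring; replace (y * Cone) with y by ring.
    assert (HAn : forall m, qpoch A p m <> Czero) by (intros; apply qpoch_neq_0; intros; apply HA).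
    pose proof (HAn n); pose proof (HA n) as HAn'; pose proof (HA (S n)) as HASn; simpl in HASn.
    unfold den; simpl; field; auto.
  - unfold H; rewrite !qbin_0_r by assumption.
    rewrite !Nat.add_0_r, (qpoch_first al), Cpow_mul.
    rewrite (qpoch_shift_first A p (S n) (S n)).
    replace (A * (p * p) * Cpow p n) with (A * Cpow p (S (S n))) by (simpl; ring).
    pose proof (Hq (S (S n)) (S n)); fold den; rewrite !tri_S.
    set (Q := qpoch (A * Cpow p (S (S n))) p (S n)) in *.
    cbn [Cpow qpoch]; field; auto.
  - intros i j E; unfold H.
    rewrite (qpoch_first al p i).
    replace (y * p * Cpow p i) with (y * Cpow p (S i)) by (simpl; ring).
    replace (S i + S j)%nat with (S (S (i + j))) by lia.
    replace (S i + j)%nat with (S (i + j)) by lia.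
    replace (i + S j)%nat with (S (i + j)) by lia.
    rewrite (qpoch_shift_first A p (S i) (S (S (i + j)))).
    rewrite (qpoch_shift_first A p (S i) (S (i + j))).
    replace (A * (p * p) * Cpow p i) with (A * Cpow p (S (S i))) by (simpl; ring).
    unfold den; rewrite <- E.
    pose proof (Hq (S (S i)) (S (i + j))) as H1; pose proof (Hq (S (S i)) (S (S (i + j)))) as H2.
    pose proof (HA (S i)) as H3; pose proof (HA (S (S (i + j)))) as H4.
    pose proof (qpoch_factor_neq_0 p p Hp i) as Hi; pose proof (qpoch_factor_neq_0 p p Hp j) as Hj.
    rewrite (qbin_S_l p (S i) j), (qbin_S_l p i j), !(qbin_S_r p i j) by assumption.
    rewrite !(Cpow_mul y p), !tri_S.
    change (qpoch (A * Cpow p (S (S i))) p (S (S (i + j))))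
      with (qpoch (A * Cpow p (S (S i))) p (S (i + j))
            * (Cone - A * Cpow p (S (S i)) * Cpow p (S (i + j)))) in *.
    destruct (Cmul_neq_0_inv _ _ H2) as [_ H5].
    set (Q := qpoch (A * Cpow p (S (S i))) p (S (i + j))) in *.
    cbn [qpoch].
    cbn [Cpow] in *; rewrite Cpow_add in *; field; repeat split; assumption.
Qed.

(* The confluent case of Watson's transformation: expand (b,d)_i/(wb,wd)_i by q_saalschuetz,
   exchange the order of summation and evaluate the inner sum by vwp_sum. *)
Lemma watson_confluent (p A al w b d g : Cx) (n : nat) :
  p <> Czero -> (forall n, qpoch p p n <> Czero) -> al <> Czero -> w <> Czero ->
  A * p = w * b * d -> al * g = A * p ->
  (forall n, qpoch (w * b) p n <> Czero) -> (forall n, qpoch (w * d) p n <> Czero) ->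
  (forall n, qpoch g p n <> Czero) -> (forall m, Cone - A * Cpow p m <> Czero) ->
  asum (fun i j => qbin p i j *
          ((Cone - A * Cpow p i * Cpow p i)
           * (qpoch al p i * qpoch b p i * qpoch d p i
              / (qpoch (w * b) p i * qpoch (w * d) p i * qpoch g p i))
           * Cpow (w * g) i * tri p i * tri p i / qpoch (A * Cpow p i) p (S (i + j)))) n
  = phiX p al w (w * b) (w * d) n / qpoch g p n.
Proof.
  intros Hp0 Hp Hal Hw HA Hg Hwb Hwd Hgn HAn.
  assert (Hq : forall i m, qpoch (A * Cpow p i) p m <> Czero).
  { intros i m; apply qpoch_neq_0; intros k _ E; apply (HAn (i + k)%nat).
    rewrite <- E, Cpow_add; ring. }
  (* Here k is the index of [phiX] and k + l that of the very-well-poised series; for fixed k + l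
     the Saalschuetz parameter B is A p^(k+l). *)
  set (T := fun k l j => qbin p (k + l) j * qbin p k l *
     ((Cone - A * Cpow p (k + l) * Cpow p (k + l)) * (qpoch al p (k + l) / qpoch g p (k + l))
      * tri p (k + l) * Cpow g (k + l) / qpoch (A * Cpow p (k + l)) p (S (k + l + j))
      * (Cpow (- Cone) k * tri p l * qpoch w p k * qpoch (A * Cpow p (k + l)) p k
         / (qpoch (w * b) p k * qpoch (w * d) p k)))).
  transitivity (asum (fun i j => asum (fun k l => T k l j) i) n).
  - apply asum_ext; intros i j _.
    pose proof (q_saalschuetz p i Hp0 Hp w b d (A * Cpow p i)) as HS.
    specialize (HS ltac:(transitivity (A * p * Cpow p i); [ring | rewrite HA; ring])).
    rewrite (asum_ext i _ (fun k l => (qbin p i j * ((Cone - A * Cpow p i * Cpow p i)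
        * (qpoch al p i / qpoch g p i) * tri p i * Cpow g i / qpoch (A * Cpow p i) p (S (i + j))
        / (qpoch (w * b) p i * qpoch (w * d) p i)))
        * (qbin p k l * (Cpow (- Cone) k * tri p l * qpoch w p k * qpoch (A * Cpow p i) p k
           * qpoch (w * b * Cpow p k) p l * qpoch (w * d * Cpow p k) p l)))).
    + rewrite asum_scal, HS, Cpow_mul.
      pose proof (Hwb i); pose proof (Hwd i); pose proof (Hgn i); pose proof (Hq i (S (i + j))).
      set (Q := qpoch (A * Cpow p i) p (S (i + j))) in *.
      field; repeat split; assumption.
    + intros k l <-; unfold T.
      pose proof (Hwb k); pose proof (Hwd k); pose proof (Hgn (k + l)%nat).
      pose proof (Hq (k + l)%nat (S (k + l + j))).
      pose proof (Hwb (k + l)%nat) as H3; pose proof (Hwd (k + l)%nat) as H4.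
      rewrite (qpoch_add (w * b)), (qpoch_add (w * d)) in *.
      destruct (Cmul_neq_0_inv _ _ H3) as [_ H5]; destruct (Cmul_neq_0_inv _ _ H4) as [_ H6].
      set (Q := qpoch (A * Cpow p (k + l)) p (S (k + l + j))) in *.
      field; repeat split; assumption.
  - rewrite asum_assoc; unfold phiX.
    transitivity (Cinv (qpoch g p n) * asum (fun i j => qbin p i j *
      (qpoch al p i * qpoch w p i / (qpoch (w * b) p i * qpoch (w * d) p i)
       * (Cpow (- (w * b * (w * d) / (al * w))) i * tri p i))) n); [| unfold Cdiv; ring].
    rewrite <- asum_scal; apply asum_ext; intros k m <-.
    (* Up to factors depending on k and m only, the inner sum is [vwp_sum] with A, al, y taken as A
       p^(2k), al p^k, g p^k. *)
    set (A2 := A * Cpow p k * Cpow p k).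
    rewrite (asum_ext m _ (fun l j => (qbin p k m * (qpoch al p k * Cpow g k * tri p k
        * Cpow (- Cone) k * qpoch w p k
        / (qpoch (w * b) p k * qpoch (w * d) p k * qpoch g p (k + m))))
        * (qbin p l j * ((Cone - A2 * Cpow p l * Cpow p l) * qpoch (al * Cpow p k) p l
           * Cpow (g * Cpow p k) l * tri p l * tri p l
           * qpoch (g * Cpow p k * Cpow p l) p j / qpoch (A2 * Cpow p l) p (S (l + j)))))).
    + rewrite asum_scal, vwp_sum.
      * replace (- (w * b * (w * d) / (al * w))) with (- Cone * g).
        -- rewrite Cpow_mul.
           pose proof (Hwb k); pose proof (Hwd k); pose proof (Hgn (k + m)%nat).
           field; repeat split; assumption.
        -- apply (Cmul_cancel_l al); [exact Hal |].
           transitivity (- (al * g)); [ring |].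
           rewrite Hg, HA; field; split; assumption.
      * exact Hp.
      * unfold A2; transitivity (al * g * (Cpow p k * Cpow p k)); [ring | rewrite Hg; ring].
      * intros e E; apply (HAn (k + k + e)%nat); rewrite <- E; unfold A2; rewrite !Cpow_add; ring.
    + intros l j <-; unfold T.
      rewrite qbin_trinomial by assumption.
      replace (S (k + l + j)) with (k + S (l + j))%nat by lia.
      pose proof (Hq (k + l)%nat k) as H1; pose proof (Hq (k + l)%nat (k + S (l + j))%nat) as H2.
      (* The first k factors of the long denominator cancel the Saalschuetz factor (A
         p^(k+l);p)_k. *)
      rewrite (qpoch_add (A * Cpow p (k + l)) p k) in *.
      replace (A * Cpow p (k + l) * Cpow p k) with (A2 * Cpow p l) in *
        by (unfold A2; rewrite Cpow_add; ring).
      destruct (Cmul_neq_0_inv _ _ H2) as [_ H3].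
      rewrite (qpoch_add al), tri_add, (Cpow_mul g), (Cpow_add g).
      pose proof (Hgn (k + (l + j))%nat) as H4; pose proof (Hgn (k + l)%nat) as H5.
      rewrite Nat.add_assoc, (qpoch_add g p (k + l) j) in *.
      replace (g * Cpow p k * Cpow p l) with (g * Cpow p (k + l)) by (rewrite Cpow_add; ring).
      destruct (Cmul_neq_0_inv _ _ H4) as [_ H6].
      pose proof (Hwb k); pose proof (Hwd k).
      set (Q := qpoch (A2 * Cpow p l) p (S (l + j))) in *.
      set (Q1 := qpoch (A * Cpow p (k + l)) p k) in *.
      set (Q2 := qpoch (g * Cpow p (k + l)) p j) in *.
      unfold A2; rewrite Cpow_add; field; repeat split; assumption.
Qed.

(** * Bilateral sums *)

Lemma Cpowz_nat (u : Cx) (n : nat) : Cpowz u (Z.of_nat n) = Cpow u n.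
Proof. destruct n as [| n]; [reflexivity |]; simpl; rewrite SuccNat2Pos.id_succ; reflexivity. Qed.

Lemma Cpowz_opp_nat (u : Cx) (n : nat) : Cpowz u (- Z.of_nat n) = Cinv (Cpow u n).
Proof.
  destruct n as [| n]; [simpl; field; apply Cone_neq_0 |].
  simpl; rewrite SuccNat2Pos.id_succ; reflexivity.
Qed.

Lemma Z_nat_or_neg (r : Z) :
  (exists n, r = Z.of_nat n) \/ (exists n, r = (- Z.of_nat (S n))%Z).
Proof.
  destruct (Z.le_gt_cases 0 r) as [H | H].
  - left; exists (Z.to_nat r); lia.
  - right; exists (Z.to_nat (- r - 1)); lia.
Qed.

Lemma Cpowz_succ (u : Cx) (r : Z) : u <> Czero -> Cpowz u (r + 1) = Cpowz u r * u.
Proof.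
  intros Hu; destruct (Z_nat_or_neg r) as [[n ->] | [n ->]].
  - replace (Z.of_nat n + 1)%Z with (Z.of_nat (S n)) by lia; rewrite !Cpowz_nat; reflexivity.
  - replace (- Z.of_nat (S n) + 1)%Z with (- Z.of_nat n)%Z by lia; rewrite !Cpowz_opp_nat.
    pose proof (Cpow_neq_0 u n Hu); simpl; field; auto.
Qed.

Lemma Cpowz_add_nat (u : Cx) (r : Z) (n : nat) :
  u <> Czero -> Cpowz u (r + Z.of_nat n) = Cpowz u r * Cpow u n.
Proof.
  intros Hu; induction n as [| n IH].
  - rewrite Z.add_0_r; simpl; ring.
  - replace (r + Z.of_nat (S n))%Z with (r + Z.of_nat n + 1)%Z by lia.
    rewrite Cpowz_succ, IH by exact Hu; simpl; ring.
Qed.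

Lemma Cpowz_add (u : Cx) (r s : Z) : u <> Czero -> Cpowz u (r + s) = Cpowz u r * Cpowz u s.
Proof.
  intros Hu; destruct (Z_nat_or_neg s) as [[n ->] | [n ->]].
  - rewrite Cpowz_add_nat, Cpowz_nat by exact Hu; reflexivity.
  - set (m := S n); pose proof (Cpow_neq_0 u m Hu).
    apply (Cmul_cancel_l (Cpow u m)); [assumption |].
    transitivity (Cpowz u (r + - Z.of_nat m) * Cpow u m); [ring |].
    rewrite <- Cpowz_add_nat, Cpowz_opp_nat by exact Hu.
    replace (r + - Z.of_nat m + Z.of_nat m)%Z with r by lia; field; assumption.
Qed.

Lemma Cpow_inv (u : Cx) (n : nat) : u <> Czero -> Cpow (Cinv u) n = Cinv (Cpow u n).
Proof.
  intros Hu; induction n as [| n IH]; simpl; [field; apply Cone_neq_0 |].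
  rewrite IH; pose proof (Cpow_neq_0 u n Hu); field; auto.
Qed.

(* lreg x p: (x;p)_r is defined for all r < 0; reg x p: moreover (x;p)_r <> 0 for all r. *)
Definition lreg (x p : Cx) : Prop := forall n, Cone - x * Cinv (Cpow p (S n)) <> Czero.
Definition reg (x p : Cx) : Prop := forall r, Cone - x * Cpowz p r <> Czero.

Lemma reg_lreg (x p : Cx) : reg x p -> lreg x p.
Proof. intros H n; rewrite <- Cpowz_opp_nat; apply H. Qed.

Lemma qpochZ_nat (x p : Cx) (n : nat) : qpochZ x p (Z.of_nat n) = qpoch x p n.
Proof. destruct n as [| n]; [reflexivity |]; simpl; rewrite SuccNat2Pos.id_succ; reflexivity. Qed.

Lemma qpochZ_opp_nat (x p : Cx) (n : nat) :
  qpochZ x p (- Z.of_nat n) = Cinv (qpoch (x * Cinv (Cpow p n)) p n).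
Proof.
  destruct n as [| n]; [simpl; field; apply Cone_neq_0 |].
  simpl Z.opp; unfold qpochZ; rewrite SuccNat2Pos.id_succ; reflexivity.
Qed.

Lemma qpoch_shift_down (x p : Cx) (n : nat) :
  p <> Czero ->
  qpoch (x * Cinv (Cpow p (S n))) p (S n)
  = (Cone - x * Cinv (Cpow p (S n))) * qpoch (x * Cinv (Cpow p n)) p n.
Proof.
  intros Hp; rewrite qpoch_first; pose proof (Cpow_neq_0 p n Hp).
  replace (x * Cinv (Cpow p (S n)) * p) with (x * Cinv (Cpow p n)) by (simpl; field; auto).
  reflexivity.
Qed.

Lemma lreg_of_qdef (x p : Cx) : p <> Czero -> (forall r, qdef x p r) -> lreg x p.
Proof.
  (* This index is -(n+1), and its product begins with the factor 1 - x p^-(n+1). *)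
  intros Hp H n; specialize (H (Zneg (Pos.of_succ_nat n))); simpl qdef in H.
  rewrite SuccNat2Pos.id_succ, qpoch_shift_down in H by exact Hp.
  exact (proj1 (Cmul_neq_0_inv _ _ H)).
Qed.

Lemma reg_of_qnz (x p : Cx) : p <> Czero -> (forall r, qnz x p r) -> reg x p.
Proof.
  intros Hp H r; destruct (Z_nat_or_neg r) as [[n ->] | [n ->]].
  - rewrite Cpowz_nat; destruct (H (Z.of_nat (S n))) as [_ H1].
    rewrite qpochZ_nat in H1; exact (proj2 (Cmul_neq_0_inv _ _ H1)).
  - rewrite Cpowz_opp_nat; apply lreg_of_qdef; [exact Hp | intros; apply H].
Qed.

(** Factors with r > 0 occur in (xp;p)_oo, those with r < 0 occur up to a nonzero multiple in
    (p/x;p)_oo, and r = 0 is 1 - x. Applied to x = -az/q, this makes the denominators of (iii)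
    control 1 - x p^r for every integer r. *)
Lemma reg_of_qinf (x p : Cx) :
  p <> Czero -> (Cnorm p < 1)%R -> x <> Czero -> Cone - x <> Czero ->
  qinf (x * p) p <> Czero -> qinf (p / x) p <> Czero -> reg x p.
Proof.
  intros Hp0 Hp Hx H1 H2 H3 r; destruct (Z_nat_or_neg r) as [[[| n] ->] | [n ->]].
  - replace (x * Cpowz p (Z.of_nat 0)) with x by (simpl; ring); exact H1.
  - rewrite Cpowz_nat.
    pose proof (qpoch_factor_neq_0 _ _ (fun m => qpoch_neq_0_of_qinf _ _ m Hp0 Hp H2) n) as H.
    intros E; apply H; rewrite <- E; simpl; ring.
  - rewrite Cpowz_opp_nat.
    pose proof (qpoch_factor_neq_0 _ _ (fun m => qpoch_neq_0_of_qinf _ _ m Hp0 Hp H3) n) as H.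
    pose proof (Cpow_neq_0 p n Hp0).
    intros E; apply H.
    transitivity (- (p / x * Cpow p n) * (Cone - x * Cinv (Cpow p (S n))));
      [simpl; field; auto | rewrite E; ring].
Qed.

Lemma lreg_qpoch (x p : Cx) (n : nat) :
  p <> Czero -> lreg x p -> qpoch (x * Cinv (Cpow p n)) p n <> Czero.
Proof.
  intros Hp H; induction n as [| n IH]; [apply Cone_neq_0 |].
  rewrite qpoch_shift_down by exact Hp; apply Cmul_neq_0; [apply H | exact IH].
Qed.

Lemma reg_qpoch (x p : Cx) (n m : nat) :
  p <> Czero -> reg x p -> qpoch (x * Cinv (Cpow p n)) p m <> Czero.
Proof.
  intros Hp H; apply qpoch_neq_0; intros k _ E; apply (H (- Z.of_nat n + Z.of_nat k)%Z).
  rewrite <- E, Cpowz_add_nat, Cpowz_opp_nat by exact Hp; ring.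
Qed.

Lemma qpochZ_succ (x p : Cx) (r : Z) :
  p <> Czero -> lreg x p -> qpochZ x p (r + 1) = qpochZ x p r * (Cone - x * Cpowz p r).
Proof.
  intros Hp Hx; destruct (Z_nat_or_neg r) as [[n ->] | [n ->]].
  - replace (Z.of_nat n + 1)%Z with (Z.of_nat (S n)) by lia.
    rewrite !qpochZ_nat, Cpowz_nat; reflexivity.
  - replace (- Z.of_nat (S n) + 1)%Z with (- Z.of_nat n)%Z by lia.
    rewrite !qpochZ_opp_nat, Cpowz_opp_nat, qpoch_shift_down by exact Hp.
    pose proof (Hx n) as H1; pose proof (lreg_qpoch x p n Hp Hx) as H2.
    set (u := Cone - x * Cinv (Cpow p (S n))) in *; field; auto.
Qed.

Lemma qpochZ_neq_0 (x p : Cx) (r : Z) : p <> Czero -> reg x p -> qpochZ x p r <> Czero.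
Proof.
  intros Hp H; destruct (Z_nat_or_neg r) as [[n ->] | [n ->]].
  - rewrite qpochZ_nat; apply qpoch_neq_0; intros k _; rewrite <- Cpowz_nat; apply H.
  - rewrite qpochZ_opp_nat; apply Cinv_neq_0, reg_qpoch; assumption.
Qed.

(** Each factor 1 - x p^-k equals -x p^-k (1 - p^k/x). The shifted product on the left diverges in
    general, whereas (p/x;p)_n tends to (p/x;p)_oo; this is where the products on q^2/a, -qb/(az)
    and -qd/(az) come from. *)
Lemma qpoch_reflect (x p : Cx) (n : nat) :
  p <> Czero -> x <> Czero ->
  qpoch (x * Cinv (Cpow p n)) p n * (tri p n * Cpow p n) = Cpow (- x) n * qpoch (p / x) p n.
Proof.
  intros Hp Hx; induction n as [| n IH]; [simpl; ring |].
  rewrite qpoch_shift_down by exact Hp; pose proof (Cpow_neq_0 p n Hp).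
  transitivity ((Cone - x * Cinv (Cpow p (S n))) * Cpow p (S n)
    * (qpoch (x * Cinv (Cpow p n)) p n * (tri p n * Cpow p n))); [simpl; ring |].
  rewrite IH; simpl; field; auto.
Qed.

(** * Bilateral terms as first-order recurrences, and weighted limits *)

(** [sig u] stands for 1/rho(1/u) with the negative powers of u cleared, so that its limit at u = 0
    governs the decay of the negative half. The inversion is demanded only at negative powers of p,
    because at nonnegative powers [rho] vanishes when a numerator factorial terminates. *)
Lemma bilateral_geometric (p : Cx) (g : Z -> Cx) (rho sig : Cx -> Cx) (L1 L2 : Cx) :
  p <> Czero -> (forall r, g (r + 1)%Z = g r * rho (Cpowz p r)) ->
  (forall n, rho (Cinv (Cpow p (S n))) * sig (Cpow p (S n)) = Cone) ->
  Ccv (fun n => rho (Cpow p n)) L1 -> (Cnorm L1 < 1)%R ->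
  Ccv (fun n => sig (Cpow p n)) L2 -> (Cnorm L2 < 1)%R ->
  geometric (fun k => g (Z.of_nat k)) /\ geometric (fun k => g (- Z.of_nat (S k))%Z).
Proof.
  intros Hp Hg Hsig HL1 H1 HL2 H2; split.
  - apply (geometric_of_ratio _ (fun n => rho (Cpow p n)) L1); [| exact HL1 | exact H1].
    intros n; rewrite <- Cpowz_nat, <- Hg; f_equal; lia.
  - apply (geometric_of_ratio _ (fun n => sig (Cpow p (S (S n)))) L2); [| | exact H2].
    + intros n.
      replace (- Z.of_nat (S n))%Z with (- Z.of_nat (S (S n)) + 1)%Z by lia.
      rewrite Hg, Cpowz_opp_nat.
      transitivity (g (- Z.of_nat (S (S n)))%Z
        * (rho (Cinv (Cpow p (S (S n)))) * sig (Cpow p (S (S n))))); [rewrite Hsig |]; ring.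
    + apply (Ccv_subseq (fun n => sig (Cpow p n)) L2 (fun n => S (S n)) 0); [intros; lia | exact HL2].
Qed.

(** Solutions of the same first-order recurrence differ by their value at the centre N. Above N one
    multiplies by [rho]; below N the exponent m - N is negative and [sig] undoes the step. *)
Lemma proportional (p : Cx) (g : Z -> Cx) (rho sig : Cx -> Cx) (x : nat -> Cx) (N M : nat) :
  p <> Czero -> (forall r, g (r + 1)%Z = g r * rho (Cpowz p r)) -> g 0%Z = Cone ->
  (forall n, rho (Cinv (Cpow p (S n))) * sig (Cpow p (S n)) = Cone) ->
  (forall m, (m < M)%nat -> x (S m) = x m * rho (Cpow p m * Cinv (Cpow p N))) ->
  (N <= M)%nat -> forall m, (m <= M)%nat -> x m = x N * g (Z.of_nat m - Z.of_nat N)%Z.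
Proof.
  intros Hp Hg Hg0 Hsig Hx HN.
  assert (Hpow : forall m, Cpowz p (Z.of_nat m - Z.of_nat N) = Cpow p m * Cinv (Cpow p N)).
  { intros m; replace (Z.of_nat m - Z.of_nat N)%Z with (- Z.of_nat N + Z.of_nat m)%Z by lia.
    rewrite Cpowz_add_nat, Cpowz_opp_nat by exact Hp; ring. }
  assert (Hrec : forall m, g (Z.of_nat (S m) - Z.of_nat N)%Z
                  = g (Z.of_nat m - Z.of_nat N)%Z * rho (Cpow p m * Cinv (Cpow p N))).
  { intros m; rewrite <- Hpow, <- Hg; f_equal; lia. }
  assert (Hdown : forall k, (k <= N)%nat -> x (N - k)%nat = x N * g (Z.of_nat (N - k) - Z.of_nat N)%Z).
  { induction k as [| k IH]; intros Hk.
    - rewrite Nat.sub_0_r, Z.sub_diag, Hg0; ring.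
    - specialize (IH ltac:(lia)).
      replace (N - k)%nat with (S (N - S k)) in IH by lia.
      rewrite Hx, Hrec in IH by lia; set (m := (N - S k)%nat) in *.
      assert (E : Cpow p m * Cinv (Cpow p N) = Cinv (Cpow p (S k))).
      { rewrite <- Hpow, <- Cpowz_opp_nat; f_equal; lia. }
      rewrite E in IH.
      transitivity (x m * (rho (Cinv (Cpow p (S k))) * sig (Cpow p (S k)))); [rewrite Hsig; ring |].
      transitivity (x m * rho (Cinv (Cpow p (S k))) * sig (Cpow p (S k))); [ring |].
      rewrite IH.
      transitivity (x N * g (Z.of_nat m - Z.of_nat N)%Z
        * (rho (Cinv (Cpow p (S k))) * sig (Cpow p (S k)))); [ring | rewrite Hsig; ring]. }
  assert (Hup : forall k, (N + k <= M)%nat -> x (N + k)%nat = x N * g (Z.of_nat (N + k) - Z.of_nat N)%Z).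
  { induction k as [| k IH]; intros Hk.
    - rewrite Nat.add_0_r, Z.sub_diag, Hg0; ring.
    - rewrite Nat.add_succ_r, Hx, Hrec, IH by lia; ring. }
  intros m Hm; destruct (Nat.le_gt_cases m N) as [H | H].
  - replace m with (N - (N - m))%nat by lia; apply Hdown; lia.
  - replace m with (N + (m - N))%nat by lia; apply Hup; lia.
Qed.

(** A terminating series re-indexed around its centre: i = n + r and j = n - r, with the weight
    separated according to which of i + j, i, j drives each factor to its limit. *)
Definition wsum (P Q R : nat -> Cx) (g : Z -> Cx) (n : nat) : Cx :=
  asum (fun i j => P (i + j)%nat * Q i * R j * g (Z.of_nat i - Z.of_nat n)%Z) (n + n).

Lemma wsum_limit (P Q R : nat -> Cx) (g : Z -> Cx) (P0 Q0 R0 : Cx) :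
  Ccv P P0 -> Ccv Q Q0 -> Ccv R R0 ->
  geometric (fun k => g (Z.of_nat k)) -> geometric (fun k => g (- Z.of_nat (S k))%Z) ->
  exists S0, bisum_cv g S0 /\ Ccv (wsum P Q R g) (P0 * Q0 * R0 * S0).
Proof.
  intros HP HQ HR Hpos Hneg.
  destruct (geometric_summable _ Hpos) as [S1 HS1].
  destruct (geometric_summable _ Hneg) as [S2 HS2].
  exists (S1 + S2); split; [exists S1, S2; auto |].
  destruct (Ccv_bounded _ _ HP) as [BP [HBP0 HBP]].
  destruct (Ccv_bounded _ _ HQ) as [BQ [HBQ0 HBQ]].
  destruct (Ccv_bounded _ _ HR) as [BR [HBR0 HBR]].
  assert (Hw : forall i j k, (Cnorm (P i * Q j * R k)%Cx <= BP * BQ * BR)%R).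
  { intros i j k; rewrite !Cnorm_mul.
    repeat (apply Rmult_le_compat; try apply Rmult_le_pos; try apply Cnorm_ge_0); auto. }
  (* A [Csum] has at least one term, so at n = 0 the negative half could not be empty; the limit is
     therefore taken along S n. *)
  assert (Hshift : forall u l, Ccv (fun n => u (S n)) l -> Ccv u l).
  { intros u l H eps Heps; destruct (H eps Heps) as [K HK]; exists (S K); intros [| n] Hn; [lia |].
    apply HK; lia. }
  apply Hshift.
  apply Ccv_ext with (fun n =>
    Csum (fun k => g (Z.of_nat k) * (P (S n + S n)%nat * Q (S n + k)%nat * R (S n - k)%nat)) (S n)
    + Csum (fun k => g (- Z.of_nat (S k))%Z * (P (S n + S n)%nat * Q (n - k)%nat * R (S (S (n + k))))) n).
  { intros n; unfold wsum; rewrite asum_Csum.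
    replace (S n + S n)%nat with (n + S (S n))%nat by lia.
    rewrite Csum_split.
    replace (n + S (S n))%nat with (S n + S n)%nat by lia.
    match goal with |- ?a + ?b = ?c + ?d => transitivity (b + a); [ring |]; f_equal end.
    - symmetry; rewrite Csum_rev; symmetry; apply Csum_ext_le; intros k Hk; cbv beta.
      replace (n - k + (S n + S n - (n - k)))%nat with (S n + S n)%nat by lia.
      replace (S n + S n - (n - k))%nat with (S (S (n + k))) by lia.
      replace (Z.of_nat (n - k) - Z.of_nat (S n))%Z with (- Z.of_nat (S k))%Z by lia; ring.
    - apply Csum_ext_le; intros k Hk; cbv beta.
      replace (S n + k + (S n + S n - (S n + k)))%nat with (S n + S n)%nat by lia.
      replace (S n + S n - (S n + k))%nat with (S n - k)%nat by lia.
      replace (Z.of_nat (S n + k) - Z.of_nat (S n))%Z with (Z.of_nat k) by lia; ring. }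
  replace (P0 * Q0 * R0 * (S1 + S2)) with (P0 * Q0 * R0 * S1 + P0 * Q0 * R0 * S2) by ring.
  apply Ccv_add.
  - apply (tannery (fun k => g (Z.of_nat k))
      (fun n k => P (S n + S n)%nat * Q (S n + k)%nat * R (S n - k)%nat)
      S1 _ (BP * BQ * BR) S 0); auto.
    + intros k; repeat apply Ccv_mul.
      * apply (Ccv_subseq P P0 (fun n => (S n + S n)%nat) 0); [intros; lia | exact HP].
      * apply (Ccv_subseq Q Q0 (fun n => (S n + k)%nat) 0); [intros; lia | exact HQ].
      * apply (Ccv_subseq R R0 (fun n => (S n - k)%nat) k); [intros; lia | exact HR].
    + intros; lia.
  - apply (tannery (fun k => g (- Z.of_nat (S k))%Z)
      (fun n k => P (S n + S n)%nat * Q (n - k)%nat * R (S (S (n + k))))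
      S2 _ (BP * BQ * BR) (fun n => n) 0); auto.
    + intros k; repeat apply Ccv_mul.
      * apply (Ccv_subseq P P0 (fun n => (S n + S n)%nat) 0); [intros; lia | exact HP].
      * apply (Ccv_subseq Q Q0 (fun n => (n - k)%nat) k); [intros; lia | exact HQ].
      * apply (Ccv_subseq R R0 (fun n => S (S (n + k))) 0); [intros; lia | exact HR].
    + intros; lia.
Qed.

Lemma lreg_sub_neq_0 (x p : Cx) (n : nat) :
  p <> Czero -> lreg x p -> Cpow p (S n) - x <> Czero.
Proof.
  intros Hp H E; apply (H n); pose proof (Cpow_neq_0 p (S n) Hp).
  transitivity ((Cpow p (S n) - x) * Cinv (Cpow p (S n))); [field; assumption | rewrite E; ring].
Qed.

Lemma Ccv_eq (u : nat -> Cx) (l m : Cx) : Ccv u l -> l = m -> Ccv u m.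
Proof. intros H <-; exact H. Qed.

Ltac Ccv_rational H :=
  repeat first
    [ exact H | apply Ccv_const | apply Ccv_div | apply Ccv_mul | apply Ccv_sub | apply Ccv_add ].

Lemma one_sub_mul_0_neq_0 (x : Cx) : Cone - x * Czero <> Czero.
Proof. replace (Cone - x * Czero) with Cone by ring; apply Cone_neq_0. Qed.

Lemma qpoch_p_neq_0 (p : Cx) (n : nat) : p <> Czero -> (Cnorm p < 1)%R -> qpoch p p n <> Czero.
Proof. intros H0 H; apply qpoch_neq_0_of_qinf; auto; apply qinf_neq_0; auto. Qed.

(** * The bilateral 2psi2 series of (i) and (ii) *)

(** The general term of 2psi2(x, y; s, 0; p, t). For nonzero x, y, t the zero lower parameter makes
    the backward ratio tend to 0, so the forward half alone imposes |t| < 1. *)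
Definition psi21 (p x y s t : Cx) (r : Z) : Cx :=
  qpochZ x p r * qpochZ y p r / qpochZ s p r * Cpowz t r.

Definition psi21_ratio (x y s t u : Cx) : Cx := (Cone - x * u) * (Cone - y * u) / (Cone - s * u) * t.

Definition psi21_ratio_inv (x y s t u : Cx) : Cx := (u - s) * u / ((u - x) * (u - y) * t).

Lemma psi21_succ (p x y s t : Cx) (r : Z) :
  p <> Czero -> t <> Czero -> lreg x p -> lreg y p -> reg s p ->
  psi21 p x y s t (r + 1) = psi21 p x y s t r * psi21_ratio x y s t (Cpowz p r).
Proof.
  intros Hp Ht Hx Hy Hs; unfold psi21, psi21_ratio.
  rewrite !qpochZ_succ, Cpowz_succ by auto using reg_lreg.
  pose proof (Hs r); pose proof (qpochZ_neq_0 s p r Hp Hs); field; auto.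
Qed.

Lemma psi21_ratio_invK (p x y s t : Cx) (n : nat) :
  p <> Czero -> t <> Czero -> lreg x p -> lreg y p -> lreg s p ->
  psi21_ratio x y s t (Cinv (Cpow p (S n))) * psi21_ratio_inv x y s t (Cpow p (S n)) = Cone.
Proof.
  intros Hp Ht Hx Hy Hs; unfold psi21_ratio, psi21_ratio_inv.
  pose proof (lreg_sub_neq_0 x p n Hp Hx); pose proof (lreg_sub_neq_0 y p n Hp Hy).
  pose proof (lreg_sub_neq_0 s p n Hp Hs); pose proof (Cpow_neq_0 p (S n) Hp).
  set (u := Cpow p (S n)) in *; field; repeat split; assumption.
Qed.

Lemma psi21_geometric (p x y s t : Cx) :
  p <> Czero -> (Cnorm p < 1)%R -> x <> Czero -> y <> Czero -> t <> Czero -> (Cnorm t < 1)%R ->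
  lreg x p -> lreg y p -> reg s p ->
  geometric (fun k => psi21 p x y s t (Z.of_nat k))
  /\ geometric (fun k => psi21 p x y s t (- Z.of_nat (S k))).
Proof.
  intros Hp0 Hp Hx0 Hy0 Ht0 Ht Hx Hy Hs; pose proof (Ccv_Cpow_0 p Hp) as Hcv.
  apply (bilateral_geometric p _ (psi21_ratio x y s t) (psi21_ratio_inv x y s t) t Czero).
  - exact Hp0.
  - intros r; apply psi21_succ; assumption.
  - intros n; apply psi21_ratio_invK; try assumption; apply reg_lreg; assumption.
  - unfold psi21_ratio; eapply Ccv_eq; [Ccv_rational Hcv | ].
    + apply one_sub_mul_0_neq_0.
    + field; apply Cone_neq_0.
  - exact Ht.
  - assert (Hden : (Czero - x) * (Czero - y) * t <> Czero).
    { replace ((Czero - x) * (Czero - y) * t) with (x * y * t) by ring.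
      repeat apply Cmul_neq_0; assumption. }
    unfold psi21_ratio_inv; eapply Ccv_eq; [Ccv_rational Hcv; exact Hden | ].
    unfold Cdiv; ring.
  - rewrite Cnorm_0; lra.
Qed.

(** The factor in front is the central term. Shifting x, y, s together makes the term ratio a
    function of p^(i-N) alone, while the unshifted t supplies the weight (t;p)_j/(p;p)_j. *)
Lemma phiY_wsum (p x y s t : Cx) (N : nat) :
  p <> Czero -> (forall n, qpoch p p n <> Czero) -> t <> Czero ->
  lreg x p -> lreg y p -> reg s p ->
  phiY p (x * Cinv (Cpow p N)) (y * Cinv (Cpow p N)) (s * Cinv (Cpow p N)) t (N + N)
  = qpoch (x * Cinv (Cpow p N)) p N * qpoch (y * Cinv (Cpow p N)) p N
    / qpoch (s * Cinv (Cpow p N)) p N * Cpow t N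
    * wsum (qpoch p p) (fun i => Cinv (qpoch p p i)) (fun j => qpoch t p j / qpoch p p j)
        (psi21 p x y s t) N.
Proof.
  intros Hp Hpp Ht Hx Hy Hs.
  set (v := fun i => qpoch (x * Cinv (Cpow p N)) p i * qpoch (y * Cinv (Cpow p N)) p i
    / qpoch (s * Cinv (Cpow p N)) p i * Cpow t i).
  change (phiY p (x * Cinv (Cpow p N)) (y * Cinv (Cpow p N)) (s * Cinv (Cpow p N)) t (N + N)
    = v N * wsum (qpoch p p) (fun i => Cinv (qpoch p p i)) (fun j => qpoch t p j / qpoch p p j)
        (psi21 p x y s t) N).
  unfold phiY, wsum; rewrite <- asum_scal; apply asum_ext; intros i j Hij.
  transitivity (qpoch p p (i + j) * Cinv (qpoch p p i) * (qpoch t p j / qpoch p p j) * v i).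
  { unfold qbin, v; pose proof (Hpp i); pose proof (Hpp j).
    pose proof (reg_qpoch s p N i Hp Hs); set (Q := qpoch (s * Cinv (Cpow p N)) p i) in *.
    field; auto. }
  rewrite (proportional p (psi21 p x y s t) (psi21_ratio x y s t) (psi21_ratio_inv x y s t)
             v N (N + N)); try lia; [ring | exact Hp | | | |].
  - intros r; apply psi21_succ; assumption.
  - unfold psi21; simpl; field; apply Cone_neq_0.
  - intros n; apply psi21_ratio_invK; try assumption; apply reg_lreg; assumption.
  - intros m _; unfold v, psi21_ratio; simpl.
    pose proof (reg_qpoch s p N m Hp Hs); pose proof (reg_qpoch s p N (S m) Hp Hs) as H1.
    simpl in H1; apply Cmul_neq_0_inv in H1 as [_ H1].
    replace (x * (Cpow p m * Cinv (Cpow p N))) with (x * Cinv (Cpow p N) * Cpow p m) by ring.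
    replace (y * (Cpow p m * Cinv (Cpow p N))) with (y * Cinv (Cpow p N) * Cpow p m) by ring.
    replace (s * (Cpow p m * Cinv (Cpow p N))) with (s * Cinv (Cpow p N) * Cpow p m) by ring.
    set (X := x * Cinv (Cpow p N)) in *; set (Y := y * Cinv (Cpow p N)) in *.
    set (Z := s * Cinv (Cpow p N)) in *; field; auto.
Qed.

Lemma psi21_limit (p x y s t : Cx) :
  p <> Czero -> (Cnorm p < 1)%R -> x <> Czero -> y <> Czero -> t <> Czero -> (Cnorm t < 1)%R ->
  lreg x p -> lreg y p -> reg s p ->
  exists T, bisum_cv (psi21 p x y s t) T /\
    Ccv (wsum (qpoch p p) (fun i => Cinv (qpoch p p i)) (fun j => qpoch t p j / qpoch p p j)
           (psi21 p x y s t)) (qinf t p / qinf p p * T).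
Proof.
  intros Hp0 Hp Hx0 Hy0 Ht0 Ht Hx Hy Hs.
  pose proof (qpoch_cv p p Hp0 Hp) as HP; pose proof (qinf_neq_0 p p Hp0 Hp Hp) as HP0.
  destruct (psi21_geometric p x y s t) as [G1 G2]; try assumption.
  destruct (wsum_limit (qpoch p p) (fun i => Cinv (qpoch p p i))
    (fun j => qpoch t p j / qpoch p p j) (psi21 p x y s t) _ _ _ HP
    (Ccv_inv _ _ HP0 HP) (Ccv_div _ _ _ _ HP0 (qpoch_cv t p Hp0 Hp) HP) G1 G2) as [T [HT HL]].
  exists T; split; [exact HT |].
  eapply Ccv_eq; [exact HL | field; exact HP0].
Qed.

(** * The series G_6 as a limit of terminating 3phi2 series *)

Definition G6_ratio (a b d y u : Cx) : Cx := (Cone - a * u) * y * u / ((Cone - b * u) * (Cone - d * u)).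

Definition G6_ratio_inv (a b d y u : Cx) : Cx := (u - b) * (u - d) / ((u - a) * y).

Lemma Cpowz_sqr (q : Cx) (r : Z) : q <> Czero -> Cpowz (q * q) r = Cpowz q r * Cpowz q r.
Proof.
  intros Hq; destruct (Z_nat_or_neg r) as [[n ->] | [n ->]].
  - rewrite !Cpowz_nat, Cpow_mul; reflexivity.
  - rewrite !Cpowz_opp_nat, Cpow_mul; pose proof (Cpow_neq_0 q (S n) Hq); field; assumption.
Qed.

Lemma G6term_succ (a b d z q : Cx) (r : Z) :
  q <> Czero -> z <> Czero -> lreg a (q * q) -> reg b (q * q) -> reg d (q * q) ->
  G6term a b d z q (r + 1) = G6term a b d z q r * G6_ratio a b d (z * q) (Cpowz (q * q) r).
Proof.
  intros Hq Hz Ha Hb Hd; pose proof (Cmul_neq_0 q q Hq Hq) as Hp.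
  unfold G6term, G6_ratio; cbv zeta.
  rewrite !qpochZ_succ, (Cpowz_succ z) by auto using reg_lreg.
  replace ((r + 1) * (r + 1))%Z with (r * r + r + r + 1)%Z by ring.
  rewrite Cpowz_succ, !(Cpowz_add q) by assumption.
  pose proof (Hb r) as Hbr; pose proof (Hd r) as Hdr.
  pose proof (qpochZ_neq_0 b _ r Hp Hb); pose proof (qpochZ_neq_0 d _ r Hp Hd).
  rewrite (Cpowz_sqr q r Hq) in *; field; repeat split; assumption.
Qed.

Lemma G6_ratio_invK (p a b d y : Cx) (n : nat) :
  p <> Czero -> y <> Czero -> lreg a p -> lreg b p -> lreg d p ->
  G6_ratio a b d y (Cinv (Cpow p (S n))) * G6_ratio_inv a b d y (Cpow p (S n)) = Cone.
Proof.
  intros Hp Hy Ha Hb Hd; unfold G6_ratio, G6_ratio_inv.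
  pose proof (lreg_sub_neq_0 a p n Hp Ha); pose proof (lreg_sub_neq_0 b p n Hp Hb).
  pose proof (lreg_sub_neq_0 d p n Hp Hd); pose proof (Cpow_neq_0 p (S n) Hp).
  set (u := Cpow p (S n)) in *; field; repeat split; assumption.
Qed.

Lemma Cnorm_sqr_lt_1 (q : Cx) : (Cnorm q < 1)%R -> (Cnorm (q * q)%Cx < 1)%R.
Proof. intros H; rewrite Cnorm_mul; pose proof (Cnorm_ge_0 q); nra. Qed.

Lemma G6term_geometric (a b d z q : Cx) :
  q <> Czero -> (Cnorm q < 1)%R -> a <> Czero -> z <> Czero ->
  (Cnorm (b * d / (a * z * q))%Cx < 1)%R ->
  lreg a (q * q) -> reg b (q * q) -> reg d (q * q) ->
  geometric (fun k => G6term a b d z q (Z.of_nat k))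
  /\ geometric (fun k => G6term a b d z q (- Z.of_nat (S k))).
Proof.
  intros Hq0 Hq Ha0 Hz0 Hconv Ha Hb Hd.
  pose proof (Cmul_neq_0 q q Hq0 Hq0) as Hp0; pose proof (Cnorm_sqr_lt_1 q Hq) as Hp.
  pose proof (Ccv_Cpow_0 _ Hp) as Hcv.
  (* Forwards the ratio tends to 0 because of q^(r^2); backwards it tends to -bd/(azq), the origin
     of the convergence condition. *)
  apply (bilateral_geometric (q * q) _ (G6_ratio a b d (z * q)) (G6_ratio_inv a b d (z * q))
           Czero (- (b * d / (a * z * q)))).
  - exact Hp0.
  - intros r; apply G6term_succ; assumption.
  - intros n; apply G6_ratio_invK; auto using reg_lreg, Cmul_neq_0.
  - unfold G6_ratio; eapply Ccv_eq; [Ccv_rational Hcv | ].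
    + apply Cmul_neq_0; apply one_sub_mul_0_neq_0.
    + unfold Cdiv; ring.
  - rewrite Cnorm_0; lra.
  - assert (Hden : (Czero - a) * (z * q) <> Czero).
    { replace (Czero - a) with (- a) by ring.
      apply Cmul_neq_0; [apply Copp_neq_0 | apply Cmul_neq_0]; assumption. }
    unfold G6_ratio_inv; eapply Ccv_eq; [Ccv_rational Hcv; exact Hden | ].
    replace (Czero - a) with (- a) in * by ring; field; auto using Copp_neq_0.
  - rewrite Cnorm_opp; exact Hconv.
Qed.

(** The shifts leave one factor p^-N in the argument, and for i = N + r the power p^(i(i-1)/2 - N i)
    is its central value times p^(r(r-1)/2). Since (zq)^r p^(r(r-1)/2) = z^r q^(r^2), this is the
    source of q^(r^2) in G_6. *)
Lemma phiX_wsum (a b d z q w : Cx) (N : nat) :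
  let p := q * q in
  q <> Czero -> (forall n, qpoch p p n <> Czero) -> a <> Czero -> z <> Czero -> w <> Czero ->
  - (b * d) = a * w * (z * q) ->
  lreg a p -> reg b p -> reg d p ->
  phiX p (a * Cinv (Cpow p N)) w (b * Cinv (Cpow p N)) (d * Cinv (Cpow p N)) (N + N)
  = qpoch (a * Cinv (Cpow p N)) p N
    / (qpoch (b * Cinv (Cpow p N)) p N * qpoch (d * Cinv (Cpow p N)) p N)
    * (Cpow (z * q) N / (tri p N * Cpow p N))
    * wsum (qpoch p p) (fun i => qpoch w p i / qpoch p p i) (fun j => Cinv (qpoch p p j))
        (G6term a b d z q) N.
Proof.
  intros p Hq Hpp Ha0 Hz Hw Habd Ha Hb Hd.
  pose proof (Cmul_neq_0 q q Hq Hq) as Hp; fold p in Hp.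
  pose proof (Cpow_neq_0 p N Hp) as HpN.
  set (iN := Cinv (Cpow p N)) in *.
  set (v := fun i => qpoch (a * iN) p i / (qpoch (b * iN) p i * qpoch (d * iN) p i)
    * (Cpow (z * q * iN) i * tri p i)).
  assert (HvN : v N = qpoch (a * iN) p N / (qpoch (b * iN) p N * qpoch (d * iN) p N)
    * (Cpow (z * q) N / (tri p N * Cpow p N))).
  { assert (HiN : Cpow iN N = Cinv (tri p N * tri p N * Cpow p N)).
    { unfold iN; rewrite Cpow_inv, Cpow_square by exact HpN; reflexivity. }
    unfold v; rewrite (Cpow_mul (z * q)), HiN.
    pose proof (tri_neq_0 p N Hp).
    pose proof (reg_qpoch b p N N Hp Hb) as HB; pose proof (reg_qpoch d p N N Hp Hd) as HD.
    fold iN in HB, HD.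
    set (B := qpoch (b * iN) p N) in *; set (D := qpoch (d * iN) p N) in *.
    set (A := qpoch (a * iN) p N) in *.
    field; repeat split; assumption. }
  rewrite <- HvN; unfold phiX, wsum; rewrite <- asum_scal; apply asum_ext; intros i j Hij.
  transitivity (qpoch p p (i + j) * (qpoch w p i / qpoch p p i) * Cinv (qpoch p p j) * v i).
  { unfold qbin, v; pose proof (Hpp i); pose proof (Hpp j).
    replace (- (b * iN * (d * iN) / (a * iN * w))) with (z * q * iN).
    - pose proof (reg_qpoch b p N i Hp Hb) as HB; pose proof (reg_qpoch d p N i Hp Hd) as HD.
    fold iN in HB, HD.
      set (B := qpoch (b * iN) p i) in *; set (D := qpoch (d * iN) p i) in *.
      field; auto.
    - transitivity (- (b * d) * iN / (a * w)); [rewrite Habd; field; auto |].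
      assert (iN <> Czero) by (apply Cinv_neq_0; assumption); field; auto. }
  rewrite (proportional p (G6term a b d z q) (G6_ratio a b d (z * q)) (G6_ratio_inv a b d (z * q))
             v N (N + N)); try lia; [ring | exact Hp | | | |].
  - intros r; apply G6term_succ; assumption.
  - unfold G6term; simpl; field; apply Cone_neq_0.
  - intros n; apply G6_ratio_invK; auto using reg_lreg, Cmul_neq_0.
  - intros m _; unfold v, G6_ratio; fold iN; cbn [qpoch Cpow tri].
    pose proof (reg_qpoch b p N (S m) Hp Hb) as H1; pose proof (reg_qpoch d p N (S m) Hp Hd) as H2.
    fold iN in H1, H2; cbn [qpoch] in H1, H2.
    apply Cmul_neq_0_inv in H1 as [H1 H3]; apply Cmul_neq_0_inv in H2 as [H2 H4].
    replace (a * (Cpow p m * iN)) with (a * iN * Cpow p m) by ring.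
    replace (b * (Cpow p m * iN)) with (b * iN * Cpow p m) by ring.
    replace (d * (Cpow p m * iN)) with (d * iN * Cpow p m) by ring.
    set (A := a * iN) in *; set (B := b * iN) in *; set (D := d * iN) in *.
    clearbody iN p; field; repeat split; assumption.
Qed.

Lemma G6term_limit (a b d z q w : Cx) :
  let p := q * q in
  q <> Czero -> (Cnorm q < 1)%R -> a <> Czero -> z <> Czero ->
  (Cnorm (b * d / (a * z * q))%Cx < 1)%R ->
  lreg a p -> reg b p -> reg d p ->
  exists G, bisum_cv (G6term a b d z q) G /\
    Ccv (wsum (qpoch p p) (fun i => qpoch w p i / qpoch p p i) (fun j => Cinv (qpoch p p j))
           (G6term a b d z q)) (qinf w p / qinf p p * G).
Proof.
  intros p Hq0 Hq Ha0 Hz0 Hconv Ha Hb Hd.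
  pose proof (Cmul_neq_0 q q Hq0 Hq0) as Hp0; pose proof (Cnorm_sqr_lt_1 q Hq) as Hp; fold p in Hp0, Hp.
  pose proof (qpoch_cv p p Hp0 Hp) as HP; pose proof (qinf_neq_0 p p Hp0 Hp Hp) as HP0.
  destruct (G6term_geometric a b d z q) as [G1 G2]; try assumption.
  destruct (wsum_limit (qpoch p p) (fun i => qpoch w p i / qpoch p p i)
    (fun j => Cinv (qpoch p p j)) (G6term a b d z q) _ _ _ HP
    (Ccv_div _ _ _ _ HP0 (qpoch_cv w p Hp0 Hp) HP) (Ccv_inv _ _ HP0 HP) G1 G2) as [G [HG HL]].
  exists G; split; [exact HG |].
  eapply Ccv_eq; [exact HL | field; exact HP0].
Qed.

(** * The very-well-poised bilateral series of (iii) *)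

(** In the application c, f, e are -azq/b, -azq/d, -zq. With A = -az/q the factor 1 + a z q^(4r-1)
    is the very-well-poised factor 1 - A p^(2r). *)
Definition vwp_term (q a z c f b d e : Cx) (r : Z) : Cx :=
  ((Cone + a * z * Cpowz q (4 * r - 1))
   * (qpochZ a (q * q) r * qpochZ c (q * q) r * qpochZ f (q * q) r)
   * Cpowz (b * d * z) r * Cpowz q (3 * r * r - 4 * r))
  / ((Cone + (a * z) / q) * (qpochZ b (q * q) r * qpochZ d (q * q) r * qpochZ e (q * q) r)).

(* A2 stands for A p^2. *)
Definition vwp_ratio (A A2 K a c f b d e u : Cx) : Cx :=
  (Cone - A2 * u * u) * (Cone - a * u) * (Cone - c * u) * (Cone - f * u) * (K * u * u * u)
  / ((Cone - A * u * u) * (Cone - b * u) * (Cone - d * u) * (Cone - e * u)).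

Definition vwp_ratio_inv (A A2 K a c f b d e u : Cx) : Cx :=
  (u * u - A) * (u - b) * (u - d) * (u - e) * (u * u * u)
  / ((u * u - A2) * (u - a) * (u - c) * (u - f) * K).

Lemma reg_sqr (A p : Cx) (r : Z) : p <> Czero -> reg A p -> Cone - A * Cpowz p r * Cpowz p r <> Czero.
Proof.
  intros Hp HA E; apply (HA (r + r)%Z); rewrite Cpowz_add by exact Hp; rewrite <- E; ring.
Qed.

Lemma vwp_term_succ (q a z c f b d e A : Cx) (r : Z) :
  let p := q * q in
  q <> Czero -> b * d * z <> Czero -> A = - (a * z / q) ->
  lreg a p -> lreg c p -> lreg f p -> reg b p -> reg d p -> reg e p -> reg A p ->
  vwp_term q a z c f b d e (r + 1)
  = vwp_term q a z c f b d e r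
    * vwp_ratio A (A * p * p) (b * d * z / q) a c f b d e (Cpowz p r).
Proof.
  intros p Hq Hbdz HAe Ha Hc Hf Hb Hd He HA.
  pose proof (Cmul_neq_0 q q Hq Hq) as Hp; fold p in Hp.
  pose proof (reg_sqr A p r Hp HA) as HAr; pose proof (HA 0%Z) as HA0; simpl in HA0.
  pose proof (Hb r) as Hbr; pose proof (Hd r) as Hdr; pose proof (He r) as Her.
  pose proof (qpochZ_neq_0 b p r Hp Hb); pose proof (qpochZ_neq_0 d p r Hp Hd).
  pose proof (qpochZ_neq_0 e p r Hp He).
  unfold vwp_term, vwp_ratio; fold p.
  rewrite !qpochZ_succ, (Cpowz_succ (b * d * z)) by auto using reg_lreg.
  set (t := Cpowz p r) in *.
  assert (Ht : Cpowz q (r + r) = t) by (rewrite Cpowz_add by exact Hq; symmetry; apply Cpowz_sqr, Hq).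
  assert (E1 : forall s, Cpowz q (s - 1) = Cpowz q s / q).
  { intros s; replace s with (s - 1 + 1)%Z at 2 by ring; rewrite Cpowz_succ by exact Hq.
    field; exact Hq. }
  assert (Et : Cpowz q (4 * r) = t * t).
  { replace (4 * r)%Z with (r + r + (r + r))%Z by ring; rewrite Cpowz_add, Ht by exact Hq; reflexivity. }
  assert (Et1 : Cpowz q (4 * (r + 1) - 1) = t * t * p * p / q).
  { rewrite E1; replace (4 * (r + 1))%Z with (4 * r + 1 + 1 + 1 + 1)%Z by ring.
    rewrite !Cpowz_succ, Et by exact Hq; unfold p; field; exact Hq. }
  assert (Eh : Cpowz q (3 * (r + 1) * (r + 1) - 4 * (r + 1))
               = Cpowz q (3 * r * r - 4 * r) * (t * t * t / q)).
  { replace (3 * (r + 1) * (r + 1) - 4 * (r + 1))%Z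
      with (3 * r * r - 4 * r + (r + r + (r + r) + (r + r) - 1))%Z by ring.
    rewrite Cpowz_add, E1, !(Cpowz_add q (_ + _) (r + r)), Ht by exact Hq; reflexivity. }
  rewrite Et1, Eh, E1, Et.
  replace (Cone + a * z * (t * t * p * p / q)) with (Cone - A * p * p * t * t)
    by (rewrite HAe; field; exact Hq).
  replace (Cone + a * z * (t * t / q)) with (Cone - A * t * t) by (rewrite HAe; field; exact Hq).
  replace (Cone + a * z / q) with (Cone - A * Cone) by (rewrite HAe; field; exact Hq).
  set (B := qpochZ b p r) in *; set (D := qpochZ d p r) in *; set (E := qpochZ e p r) in *.
  replace (A * Cone) with A in * by ring.
  clear HAe Ht E1 Et Et1 Eh; clearbody t p; field; repeat split; assumption.
Qed.

Lemma vwp_ratio_invK (p A K a c f b d e : Cx) (n : nat) :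
  p <> Czero -> K <> Czero ->
  lreg a p -> lreg c p -> lreg f p -> lreg b p -> lreg d p -> lreg e p -> reg A p ->
  vwp_ratio A (A * p * p) K a c f b d e (Cinv (Cpow p (S n)))
  * vwp_ratio_inv A (A * p * p) K a c f b d e (Cpow p (S n)) = Cone.
Proof.
  intros Hp HK Ha Hc Hf Hb Hd He HA.
  pose proof (lreg_sub_neq_0 a p n Hp Ha); pose proof (lreg_sub_neq_0 c p n Hp Hc).
  pose proof (lreg_sub_neq_0 f p n Hp Hf); pose proof (lreg_sub_neq_0 b p n Hp Hb).
  pose proof (lreg_sub_neq_0 d p n Hp Hd); pose proof (lreg_sub_neq_0 e p n Hp He).
  pose proof (Cpow_neq_0 p (S n) Hp); pose proof (Cpow_neq_0 p n Hp) as Hn.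
  assert (HuA : Cpow p (S n) * Cpow p (S n) - A <> Czero).
  { intros E; apply (reg_sqr A p (- Z.of_nat (S n)) Hp HA); rewrite Cpowz_opp_nat.
    transitivity ((Cpow p (S n) * Cpow p (S n) - A) / (Cpow p (S n) * Cpow p (S n)));
      [field; assumption | rewrite E; unfold Cdiv; ring]. }
  assert (HuA2 : Cpow p (S n) * Cpow p (S n) - A * p * p <> Czero).
  { intros E; apply (reg_sqr A p (- Z.of_nat n) Hp HA); rewrite Cpowz_opp_nat.
    transitivity ((Cpow p (S n) * Cpow p (S n) - A * p * p) / (Cpow p (S n) * Cpow p (S n)));
      [simpl; field; auto | rewrite E; unfold Cdiv; ring]. }
  unfold vwp_ratio, vwp_ratio_inv.
  set (u := Cpow p (S n)) in *; set (A2 := A * p * p) in *; clearbody u A2.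
  field; repeat split; assumption.
Qed.

Lemma vwp_term_geometric (q a z c f b d e A : Cx) :
  let p := q * q in
  q <> Czero -> (Cnorm q < 1)%R -> b * d * z <> Czero -> A = - (a * z / q) ->
  a <> Czero -> c <> Czero -> f <> Czero -> A <> Czero ->
  lreg a p -> lreg c p -> lreg f p -> reg b p -> reg d p -> reg e p -> reg A p ->
  geometric (fun k => vwp_term q a z c f b d e (Z.of_nat k))
  /\ geometric (fun k => vwp_term q a z c f b d e (- Z.of_nat (S k))).
Proof.
  intros p Hq0 Hq Hbdz HAe Ha0 Hc0 Hf0 HA0 Ha Hc Hf Hb Hd He HA.
  pose proof (Cmul_neq_0 q q Hq0 Hq0) as Hp0; pose proof (Cnorm_sqr_lt_1 q Hq) as Hp; fold p in Hp0, Hp.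
  pose proof (Ccv_Cpow_0 _ Hp) as Hcv.
  set (K := b * d * z / q); assert (HK : K <> Czero) by (apply Cdiv_neq_0; assumption).
  (* The factor u^3, due to q^(3r^2), sends the ratio to 0 in both directions, so this series adds
     no convergence condition. *)
  apply (bilateral_geometric p _ (vwp_ratio A (A * p * p) K a c f b d e)
           (vwp_ratio_inv A (A * p * p) K a c f b d e) Czero Czero).
  - exact Hp0.
  - intros r; apply vwp_term_succ; assumption.
  - intros n; apply vwp_ratio_invK; auto using reg_lreg.
  - unfold vwp_ratio; eapply Ccv_eq; [Ccv_rational Hcv | ].
    + repeat apply Cmul_neq_0; apply one_sub_mul_0_neq_0.
    + unfold Cdiv; ring.
  - rewrite Cnorm_0; lra.
  - assert (Hden : (Czero * Czero - A * p * p) * (Czero - a) * (Czero - c) * (Czero - f) * K <> Czero).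
    { replace ((Czero * Czero - A * p * p) * (Czero - a) * (Czero - c) * (Czero - f) * K)
        with (A * p * p * a * c * f * K) by ring.
      repeat first [assumption | apply Cmul_neq_0]. }
    unfold vwp_ratio_inv; eapply Ccv_eq; [Ccv_rational Hcv; exact Hden | ].
    unfold Cdiv; ring.
  - rewrite Cnorm_0; lra.
Qed.

(** A carries the shift p^(-2N) because A p is a product of two shifted parameters. With j = 2N - i
    the long denominator becomes (A p^-j;p)_j (1 - A) (A p;p)_i, and reflecting its first factor
    yields the convergent weights 1/(A p;p)_i and 1/(p/A;p)_j. *)
Lemma watson_wsum (q a z c f b d e A w : Cx) (N : nat) :
  let p := q * q in let iN := Cinv (Cpow p N) in
  q <> Czero -> (forall n, qpoch p p n <> Czero) -> b * d * z <> Czero -> A = - (a * z / q) ->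
  A <> Czero -> b * d * z / q = - A * w * e ->
  (forall n, qpoch (A * p) p n <> Czero) -> (forall n, qpoch (p / A) p n <> Czero) ->
  lreg a p -> lreg c p -> lreg f p -> reg b p -> reg d p -> reg e p -> reg A p ->
  asum (fun i j => qbin p i j *
          ((Cone - A * iN * iN * Cpow p i * Cpow p i)
           * (qpoch (a * iN) p i * qpoch (f * iN) p i * qpoch (c * iN) p i
              / (qpoch (b * iN) p i * qpoch (d * iN) p i * qpoch (e * iN) p i))
           * Cpow (w * (e * iN)) i * tri p i * tri p i
           / qpoch (A * iN * iN * Cpow p i) p (S (i + j)))) (N + N)
  = qpoch (a * iN) p N * qpoch (f * iN) p N * qpoch (c * iN) p N
    / (qpoch (b * iN) p N * qpoch (d * iN) p N * qpoch (e * iN) p N)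
    * (Cpow (w * e) N * tri p N / Cpow (- A) N)
    * wsum (qpoch p p) (fun i => Cinv (qpoch p p i * qpoch (A * p) p i))
        (fun j => Cinv (qpoch p p j * qpoch (p / A) p j)) (vwp_term q a z c f b d e) N.
Proof.
  intros p iN Hq Hpp Hbdz HAe HA0 HK HAp HpA Ha Hc Hf Hb Hd He HA.
  pose proof (Cmul_neq_0 q q Hq Hq) as Hp; fold p in Hp.
  pose proof (Cpow_neq_0 p N Hp) as HpN.
  assert (HiN : Cpow iN N = Cinv (tri p N * tri p N * Cpow p N)).
  { unfold iN; rewrite Cpow_inv, Cpow_square by exact HpN; reflexivity. }
  assert (HBn : forall n, qpoch (b * iN) p n <> Czero) by (intros; apply reg_qpoch; assumption).
  assert (HDn : forall n, qpoch (d * iN) p n <> Czero) by (intros; apply reg_qpoch; assumption).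
  assert (HEn : forall n, qpoch (e * iN) p n <> Czero) by (intros; apply reg_qpoch; assumption).
  assert (HA1 : Cone - A <> Czero).
  { intros E; apply (HA 0%Z); rewrite <- E; simpl; ring. }
  assert (HoA : forall n, Cpow (- A) n <> Czero) by (intros; apply Cpow_neq_0, Copp_neq_0, HA0).
  (* The last factor collects what the reflection and 1 - A leave over, so that [v] obeys exactly
     the recurrence of [vwp_term]. *)
  set (v := fun i => (Cone - A * iN * iN * Cpow p i * Cpow p i)
    * (qpoch (a * iN) p i * qpoch (f * iN) p i * qpoch (c * iN) p i
       / (qpoch (b * iN) p i * qpoch (d * iN) p i * qpoch (e * iN) p i))
    * Cpow (w * (e * iN)) i * tri p i * tri p i
    * (tri p (N + N - i) * Cpow p (N + N - i) / (Cpow (- A) (N + N - i) * (Cone - A)))).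
  assert (HvN : v N = qpoch (a * iN) p N * qpoch (f * iN) p N * qpoch (c * iN) p N
    / (qpoch (b * iN) p N * qpoch (d * iN) p N * qpoch (e * iN) p N)
    * (Cpow (w * e) N * tri p N / Cpow (- A) N)).
  { unfold v; replace (N + N - N)%nat with N by lia.
    replace (w * (e * iN)) with (w * e * iN) by ring.
    rewrite (Cpow_mul (w * e)), HiN.
    replace (A * iN * iN * Cpow p N * Cpow p N) with A by (unfold iN; field; exact HpN).
    pose proof (tri_neq_0 p N Hp); pose proof (HBn N); pose proof (HDn N); pose proof (HEn N).
    pose proof (HoA N).
    set (B := qpoch (b * iN) p N) in *; set (D := qpoch (d * iN) p N) in *.
    set (E := qpoch (e * iN) p N) in *; set (oA := Cpow (- A) N) in *.
    field; repeat split; assumption. }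
  rewrite <- HvN; unfold wsum; rewrite <- asum_scal; apply asum_ext; intros i j Hij.
  transitivity (qpoch p p (i + j) * Cinv (qpoch p p i * qpoch (A * p) p i)
                * Cinv (qpoch p p j * qpoch (p / A) p j) * v i).
  { unfold qbin, v; replace (N + N - i)%nat with j by lia.
    pose proof (Cpow_neq_0 p j Hp) as Hpj; pose proof (Cpow_neq_0 p i Hp) as Hpi.
    replace (A * iN * iN * Cpow p i) with (A * Cinv (Cpow p j)).
    2:{ unfold iN; transitivity (A * Cpow p i / (Cpow p (N + N))); [rewrite <- Hij, Cpow_add |
          rewrite Cpow_add]; field; auto. }
    replace (S (i + j)) with (j + S i)%nat by lia.
    rewrite (qpoch_add (A * Cinv (Cpow p j))).
    replace (A * Cinv (Cpow p j) * Cpow p j) with A by (field; exact Hpj).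
    rewrite (qpoch_first A).
    pose proof (qpoch_reflect A p j Hp HA0) as HR.
    pose proof (tri_neq_0 p j Hp); pose proof (reg_qpoch A p j j Hp HA).
    pose proof (Hpp i); pose proof (Hpp j); pose proof (HAp i); pose proof (HpA j); pose proof (HoA j).
    pose proof (HBn i); pose proof (HDn i); pose proof (HEn i).
    set (W := Cone - A * Cinv (Cpow p j) * Cpow p i) in *.
    set (B := qpoch (b * iN) p i) in *; set (D := qpoch (d * iN) p i) in *.
    set (E := qpoch (e * iN) p i) in *; set (oA := Cpow (- A) j) in *.
    set (Q := qpoch (A * Cinv (Cpow p j)) p j) in *; set (Qr := qpoch (p / A) p j) in *.
    replace Q with (oA * Qr / (tri p j * Cpow p j)) by (rewrite <- HR; field; auto).
    field; repeat split; assumption. }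
  rewrite (proportional p (vwp_term q a z c f b d e)
             (vwp_ratio A (A * p * p) (b * d * z / q) a c f b d e)
             (vwp_ratio_inv A (A * p * p) (b * d * z / q) a c f b d e)
             v N (N + N)); try lia; [ring | exact Hp | | | |].
  - intros r; apply vwp_term_succ; assumption.
  - unfold vwp_term; simpl.
    assert (Hz : Cone + a * z / q <> Czero).
    { intros E; apply HA1; rewrite <- E, HAe; ring. }
    replace (Cone + a * z * Cinv (Cone * q)) with (Cone + a * z / q) by (field; exact Hq).
    set (W := Cone + a * z / q) in *; field; exact Hz.
  - intros n; apply vwp_ratio_invK; auto using reg_lreg, Cdiv_neq_0.
  - intros m Hm; unfold v, vwp_ratio; fold iN.
    replace (N + N - m)%nat with (S (N + N - S m)) by lia.
    (* This trades the power of p coming from the complementary index for the powers of p^-N in the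
       ratio. *)
    assert (Hj : Cpow p (N + N - S m) * (Cpow p m * p) = Cpow p N * Cpow p N).
    { rewrite <- Cpow_add; change (Cpow p m * p) with (Cpow p (S m)); rewrite <- Cpow_add.
      f_equal; lia. }
    set (l := (N + N - S m)%nat) in *.
    pose proof (HBn (S m)) as H1; pose proof (HDn (S m)) as H2; pose proof (HEn (S m)) as H3.
    pose proof (HoA l) as H4; pose proof (Cpow_neq_0 p l Hp) as H5.
    pose proof (Cpow_neq_0 p m Hp) as H6; pose proof (Copp_neq_0 A HA0) as H7.
    pose proof (reg_sqr A p (- Z.of_nat N + Z.of_nat m) Hp HA) as H8.
    rewrite Cpowz_add_nat, Cpowz_opp_nat in H8 by exact Hp; fold iN in H8.
    replace (b * d * z / q * (Cpow p m * iN) * (Cpow p m * iN) * (Cpow p m * iN))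
      with (w * (e * iN) * (- A) * (Cpow p m * Cpow p m) / (Cpow p l * p)).
    2:{ rewrite HK; unfold iN.
        transitivity (- A * w * e * (Cpow p m * Cpow p m * Cpow p m) * Cinv (Cpow p N)
                      / (Cpow p l * (Cpow p m * p))); [| rewrite Hj]; field; auto. }
    replace (Cone - A * p * p * (Cpow p m * iN) * (Cpow p m * iN))
      with (Cone - A * iN * iN * Cpow p (S m) * Cpow p (S m)) by (simpl; ring).
    replace (Cone - A * (Cpow p m * iN) * (Cpow p m * iN))
      with (Cone - A * iN * iN * Cpow p m * Cpow p m) by ring.
    replace (Cone - A * (iN * Cpow p m) * (iN * Cpow p m))
      with (Cone - A * iN * iN * Cpow p m * Cpow p m) in H8 by ring.
    replace (a * (Cpow p m * iN)) with (a * iN * Cpow p m) by ring.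
    replace (c * (Cpow p m * iN)) with (c * iN * Cpow p m) by ring.
    replace (f * (Cpow p m * iN)) with (f * iN * Cpow p m) by ring.
    replace (b * (Cpow p m * iN)) with (b * iN * Cpow p m) by ring.
    replace (d * (Cpow p m * iN)) with (d * iN * Cpow p m) by ring.
    replace (e * (Cpow p m * iN)) with (e * iN * Cpow p m) by ring.
    set (W2 := Cone - A * iN * iN * Cpow p (S m) * Cpow p (S m)).
    set (W := Cone - A * iN * iN * Cpow p m * Cpow p m) in *.
    cbn [qpoch tri Cpow] in *.
    apply Cmul_neq_0_inv in H1 as [H1 H1']; apply Cmul_neq_0_inv in H2 as [H2 H2'].
    apply Cmul_neq_0_inv in H3 as [H3 H3'].
    set (B := b * iN) in *; set (D := d * iN) in *; set (E := e * iN) in *.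
    set (X := a * iN) in *; set (Y := c * iN) in *; set (Z := f * iN) in *.
    set (oA := Cpow (- A) l) in *.
    clearbody W W2 B D E X Y Z oA; clear HAe HK; clearbody p; field; repeat split; assumption.
Qed.

(** * Finite forms of the three identities *)

(** Splitting (b p^-N;p)_(2N) = (b p^-N;p)_N (b;p)_N, and likewise for d and e, cancels the shifted
    halves against the central terms; the shifted factors of a, c, f are reflected. Every remaining
    factor converges. *)
Lemma G6_finite_i (a b d z q w c f e : Cx) (N : nat) :
  let p := q * q in
  q <> Czero -> (forall n, qpoch p p n <> Czero) ->
  a <> Czero -> b <> Czero -> d <> Czero -> z <> Czero -> w <> Czero ->
  e = - (z * q) -> - (b * d) = a * w * (z * q) -> w * c = d -> w * f = b ->
  lreg a p -> reg b p -> reg d p -> lreg c p -> lreg f p -> reg e p ->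
  qpoch b p N * qpoch d p N * qpoch (p / a) p N
    * wsum (qpoch p p) (fun i => qpoch w p i / qpoch p p i) (fun j => Cinv (qpoch p p j))
        (G6term a b d z q) N
  = qpoch e p N * qpoch (p / c) p N * qpoch (p / f) p N
    * wsum (qpoch p p) (fun i => Cinv (qpoch p p i)) (fun j => qpoch w p j / qpoch p p j)
        (psi21 p c f e w) N.
Proof.
  intros p Hq Hpp Ha0 Hb0 Hd0 Hz Hw He0 Habd Hc0 Hf0 Ha Hb Hd Hc Hf He.
  pose proof (Cmul_neq_0 q q Hq Hq) as Hp; fold p in Hp.
  pose proof (Cpow_neq_0 p N Hp) as HpN.
  assert (Hcn : c <> Czero) by (intros E; apply Hd0; rewrite <- Hc0, E; ring).
  assert (Hfn : f <> Czero) by (intros E; apply Hb0; rewrite <- Hf0, E; ring).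
  set (iN := Cinv (Cpow p N)).
  assert (HiN : iN <> Czero) by (apply Cinv_neq_0, HpN).
  assert (Ee : b * iN * (d * iN) / (a * iN * w) = e * iN).
  { rewrite He0; transitivity (- (- (b * d)) * iN / (a * w)); [field; auto |].
    rewrite Habd; field; auto. }
  pose proof (phiX_phiY_reversed p (a * iN) w (b * iN) (d * iN) (N + N) Hpp) as H.
  specialize (H ltac:(auto using Cmul_neq_0) Hw ltac:(auto using Cmul_neq_0)
                ltac:(auto using Cmul_neq_0)).
  specialize (H ltac:(intros; apply reg_qpoch; assumption) ltac:(intros; apply reg_qpoch; assumption)).
  rewrite Ee in H; specialize (H ltac:(intros; apply reg_qpoch; assumption)).
  replace (b * iN / w) with (f * iN) in H by (rewrite <- Hf0; field; exact Hw).
  replace (d * iN / w) with (c * iN) in H by (rewrite <- Hc0; field; exact Hw).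
  rewrite phiY_sym in H; unfold iN in H.
  pose proof (phiX_wsum a b d z q w N Hq Hpp Ha0 Hz Hw Habd Ha Hb Hd) as HX.
  cbv zeta in HX; fold p in HX.
  rewrite HX, phiY_wsum, !qpoch_add in H by assumption; clear HX.
  set (S := wsum _ _ _ (G6term a b d z q) N) in *; set (T := wsum _ _ _ (psi21 p c f e w) N) in *.
  pose proof (reg_qpoch b p N N Hp Hb) as HB; pose proof (reg_qpoch d p N N Hp Hd) as HD.
  pose proof (reg_qpoch e p N N Hp He) as HE.
  pose proof (qpoch_reflect a p N Hp Ha0) as Ra; pose proof (qpoch_reflect c p N Hp Hcn) as Rc.
  pose proof (qpoch_reflect f p N Hp Hfn) as Rf; fold p in H.
  fold iN in H, HB, HD, HE, Ra, Rc, Rf.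
  replace (b * iN * Cpow p N) with b in H by (unfold iN; field; exact HpN).
  replace (d * iN * Cpow p N) with d in H by (unfold iN; field; exact HpN).
  replace (e * iN * Cpow p N) with e in H by (unfold iN; field; exact HpN).
  pose proof (tri_neq_0 p N Hp) as Ht.
  set (A := qpoch (a * iN) p N) in *; set (B := qpoch (b * iN) p N) in *.
  set (C := qpoch (c * iN) p N) in *; set (D := qpoch (d * iN) p N) in *.
  set (E := qpoch (e * iN) p N) in *; set (F := qpoch (f * iN) p N) in *.
  (* The powers left by the three reflections agree since a w z q = -bd = -w^2 c f. *)
  assert (Hpow : Cpow (- a) N * Cpow (z * q) N = Cpow (- c) N * Cpow (- f) N * Cpow w N).
  { rewrite <- !Cpow_mul; f_equal; apply (Cmul_cancel_l w); [exact Hw |].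
    transitivity (- (a * w * (z * q))); [ring |]; rewrite <- Habd, <- Hc0, <- Hf0; ring. }
  apply (Cmul_cancel_l (Cpow (- a) N * Cpow (z * q) N)).
  { apply Cmul_neq_0; apply Cpow_neq_0; auto using Copp_neq_0, Cmul_neq_0. }
  set (tau := tri p N * Cpow p N) in *.
  assert (Htau : tau <> Czero) by (apply Cmul_neq_0; assumption).
  transitivity (tau * tau * (B * qpoch b p N * (D * qpoch d p N)
                  * (A / (B * D) * (Cpow (z * q) N / tau) * S))).
  { transitivity (qpoch b p N * qpoch d p N * (A * tau) * Cpow (z * q) N * S);
      [rewrite Ra; ring | field; auto]. }
  rewrite H, Hpow.
  transitivity (qpoch e p N * (C * tau) * (F * tau) * Cpow w N * T);
    [field; exact HE | rewrite Rc, Rf; ring].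
Qed.

(** The new argument b/a is a quotient of two shifted parameters, hence unshifted, and its size
    decides the convergence of the transformed series. The shifted factor of a occurs in both
    central terms and cancels; only that of c is reflected. *)
Lemma G6_finite_ii (a b d z q w c : Cx) (N : nat) :
  let p := q * q in
  q <> Czero -> (forall n, qpoch p p n <> Czero) ->
  a <> Czero -> b <> Czero -> d <> Czero -> z <> Czero -> w <> Czero ->
  - (b * d) = a * w * (z * q) -> w * c = d ->
  lreg a p -> reg b p -> reg d p -> lreg c p ->
  qpoch b p N
    * wsum (qpoch p p) (fun i => qpoch w p i / qpoch p p i) (fun j => Cinv (qpoch p p j))
        (G6term a b d z q) N
  = qpoch (p / c) p N
    * wsum (qpoch p p) (fun i => Cinv (qpoch p p i)) (fun j => qpoch (b / a) p j / qpoch p p j)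
        (psi21 p c a d (b / a)) N.
Proof.
  intros p Hq Hpp Ha0 Hb0 Hd0 Hz Hw Habd Hc0 Ha Hb Hd Hc.
  pose proof (Cmul_neq_0 q q Hq Hq) as Hp; fold p in Hp.
  pose proof (Cpow_neq_0 p N Hp) as HpN.
  assert (Hcn : c <> Czero) by (intros E; apply Hd0; rewrite <- Hc0, E; ring).
  assert (Hba : b / a <> Czero) by (apply Cdiv_neq_0; assumption).
  set (iN := Cinv (Cpow p N)).
  assert (HiN : iN <> Czero) by (apply Cinv_neq_0, HpN).
  pose proof (phiX_phiY p (a * iN) w (b * iN) (d * iN) (N + N) Hpp) as H.
  specialize (H ltac:(auto using Cmul_neq_0) Hw).
  specialize (H ltac:(intros; apply reg_qpoch; assumption) ltac:(intros; apply reg_qpoch; assumption)).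
  replace (b * iN / (a * iN)) with (b / a) in H by (field; auto).
  replace (d * iN / w) with (c * iN) in H by (rewrite <- Hc0; field; exact Hw).
  rewrite phiY_sym in H; unfold iN in H.
  pose proof (phiX_wsum a b d z q w N Hq Hpp Ha0 Hz Hw Habd Ha Hb Hd) as HX.
  cbv zeta in HX; fold p in HX.
  rewrite HX, phiY_wsum, !qpoch_add in H by assumption; clear HX.
  set (S := wsum _ _ _ (G6term a b d z q) N) in *; set (T := wsum _ _ _ (psi21 p c a d (b / a)) N) in *.
  pose proof (reg_qpoch b p N N Hp Hb) as HB; pose proof (reg_qpoch d p N N Hp Hd) as HD.
  pose proof (lreg_qpoch a p N Hp Ha) as HA.
  pose proof (qpoch_reflect c p N Hp Hcn) as Rc; fold p in H.
  fold iN in H, HB, HD, HA, Rc.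
  replace (b * iN * Cpow p N) with b in H by (unfold iN; field; exact HpN).
  pose proof (tri_neq_0 p N Hp) as Ht.
  set (A := qpoch (a * iN) p N) in *; set (B := qpoch (b * iN) p N) in *.
  set (C := qpoch (c * iN) p N) in *; set (D := qpoch (d * iN) p N) in *.
  assert (Hpow : Cpow (z * q) N = Cpow (- c) N * Cpow (b / a) N).
  { rewrite <- !Cpow_mul; f_equal; apply (Cmul_cancel_l (a * w)); [apply Cmul_neq_0; assumption |].
    rewrite <- Habd, <- Hc0; field; exact Ha0. }
  set (tau := tri p N * Cpow p N) in *.
  assert (Htau : tau <> Czero) by (apply Cmul_neq_0; assumption).
  apply (Cmul_cancel_l (Cpow (z * q) N)); [apply Cpow_neq_0, Cmul_neq_0; assumption |].
  transitivity (D * tau / A * (B * qpoch b p N * (A / (B * D) * (Cpow (z * q) N / tau) * S)));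
    [field; auto |].
  rewrite H, Hpow.
  transitivity (C * tau * Cpow (b / a) N * T); [field; auto | rewrite Rc; ring].
Qed.

(** The weight on the very-well-poised side contains A in place of w, so in the limit (w;p)_oo joins
    (A p;p)_oo and (p/A;p)_oo in the denominator of (iii). *)
Lemma G6_finite_iii (a b d z q w c f e A : Cx) (N : nat) :
  let p := q * q in
  q <> Czero -> (forall n, qpoch p p n <> Czero) ->
  a <> Czero -> b <> Czero -> d <> Czero -> z <> Czero -> w <> Czero ->
  e = - (z * q) -> A = - (a * z / q) -> - (b * d) = a * w * (z * q) -> w * c = d -> w * f = b ->
  lreg a p -> reg b p -> reg d p -> lreg c p -> lreg f p -> reg e p -> reg A p ->
  (forall n, qpoch (A * p) p n <> Czero) -> (forall n, qpoch (p / A) p n <> Czero) ->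
  wsum (qpoch p p) (fun i => qpoch w p i / qpoch p p i) (fun j => Cinv (qpoch p p j))
    (G6term a b d z q) N
  = qpoch e p N * qpoch (p / c) p N * qpoch (p / f) p N
    * wsum (qpoch p p) (fun i => Cinv (qpoch p p i * qpoch (A * p) p i))
        (fun j => Cinv (qpoch p p j * qpoch (p / A) p j)) (vwp_term q a z c f b d e) N.
Proof.
  intros p Hq Hpp Ha0 Hb0 Hd0 Hz Hw He0 HAe Habd Hc0 Hf0 Ha Hb Hd Hc Hf He HA HAp HpA.
  pose proof (Cmul_neq_0 q q Hq Hq) as Hp; fold p in Hp.
  pose proof (Cpow_neq_0 p N Hp) as HpN.
  assert (Hcn : c <> Czero) by (intros E; apply Hd0; rewrite <- Hc0, E; ring).
  assert (Hfn : f <> Czero) by (intros E; apply Hb0; rewrite <- Hf0, E; ring).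
  assert (HA0 : A <> Czero) by (rewrite HAe; auto using Copp_neq_0, Cmul_neq_0, Cdiv_neq_0).
  assert (Hbdz : b * d * z <> Czero) by auto using Cmul_neq_0.
  assert (Hbd : b * d = - (a * w * (z * q))) by (rewrite <- Habd; ring).
  assert (HK : b * d * z / q = - A * w * e).
  { rewrite Hbd, HAe, He0; field; exact Hq. }
  set (iN := Cinv (Cpow p N)).
  assert (HiN : iN <> Czero) by (apply Cinv_neq_0, HpN).
  assert (HcfA : A * p = w * f * c).
  { apply (Cmul_cancel_l w); [exact Hw |]; transitivity (b * d);
      [rewrite Hbd, HAe; unfold p; field; exact Hq | rewrite <- Hc0, <- Hf0; ring]. }
  pose proof (watson_confluent p (A * iN * iN) (a * iN) w (f * iN) (c * iN) (e * iN) (N + N)) as H.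
  replace (w * (f * iN)) with (b * iN) in H by (rewrite <- Hf0; ring).
  replace (w * (c * iN)) with (d * iN) in H by (rewrite <- Hc0; ring).
  specialize (H Hp Hpp ltac:(auto using Cmul_neq_0) Hw).
  specialize (H ltac:(transitivity (A * p * iN * iN); [ring | rewrite HcfA, <- Hf0; ring])).
  specialize (H ltac:(rewrite He0, HAe; unfold p; field; exact Hq)).
  do 3 specialize (H ltac:(intros; apply reg_qpoch; assumption)).
  specialize (H ltac:(intros m E; apply (HA (- Z.of_nat N + - Z.of_nat N + Z.of_nat m)%Z);
    rewrite Cpowz_add_nat, Cpowz_add, Cpowz_opp_nat by exact Hp; rewrite <- E; unfold iN; ring)).
  unfold iN in H.
  pose proof (phiX_wsum a b d z q w N Hq Hpp Ha0 Hz Hw Habd Ha Hb Hd) as HX.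
  pose proof (watson_wsum q a z c f b d e A w N Hq Hpp Hbdz HAe HA0 HK HAp HpA Ha Hc Hf Hb Hd He HA) as HY.
  cbv zeta in HX, HY; fold p in HX, HY.
  rewrite HX, HY, qpoch_add in H; clear HX HY.
  fold p in H.
  set (S := wsum _ _ _ (G6term a b d z q) N) in *; set (L := wsum _ _ _ (vwp_term q a z c f b d e) N) in *.
  pose proof (reg_qpoch b p N N Hp Hb) as HB; pose proof (reg_qpoch d p N N Hp Hd) as HD.
  pose proof (reg_qpoch e p N N Hp He) as HE; pose proof (lreg_qpoch a p N Hp Ha) as HAN.
  pose proof (qpoch_reflect c p N Hp Hcn) as Rc; pose proof (qpoch_reflect f p N Hp Hfn) as Rf.
  fold iN in H, HB, HD, HE, HAN, Rc, Rf.
  replace (e * iN * Cpow p N) with e in H by (unfold iN; field; exact HpN).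
  assert (Hen : qpoch e p N <> Czero).
  { apply qpoch_neq_0; intros k _; rewrite <- Cpowz_nat; apply He. }
  pose proof (tri_neq_0 p N Hp) as Ht.
  assert (HoA : Cpow (- A) N <> Czero) by (apply Cpow_neq_0, Copp_neq_0, HA0).
  set (X := qpoch (a * iN) p N) in *; set (B := qpoch (b * iN) p N) in *.
  set (C := qpoch (c * iN) p N) in *; set (D := qpoch (d * iN) p N) in *.
  set (E := qpoch (e * iN) p N) in *; set (F := qpoch (f * iN) p N) in *.
  (* The powers left by reflecting c and f agree since w f c = A p and e = -z q. *)
  assert (Hpow : Cpow (- c) N * Cpow (- f) N * Cpow (w * e) N = Cpow (- A) N * Cpow (z * q) N * Cpow p N).
  { rewrite <- !Cpow_mul; f_equal.
    transitivity (w * f * c * e); [ring |]; rewrite <- HcfA, He0; ring. }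
  set (oA := Cpow (- A) N) in *; set (en := qpoch e p N) in *.
  assert (Hzq : Cpow (z * q) N <> Czero) by (apply Cpow_neq_0, Cmul_neq_0; assumption).
  apply (Cmul_cancel_l (Cpow (z * q) N)); [exact Hzq |].
  transitivity (tri p N * Cpow p N * en * B * D * E / X
    * (X / (B * D) * (Cpow (z * q) N / (tri p N * Cpow p N)) * S / (E * en))); [field; auto 10 |].
  rewrite <- H.
  transitivity (en * (C * (tri p N * Cpow p N)) * (F * (tri p N * Cpow p N)) * Cpow (w * e) N
    / (oA * Cpow p N) * L); [field; auto 10 |].
  rewrite Rc, Rf.
  transitivity (en * qpoch (p / c) p N * qpoch (p / f) p N
    * (Cpow (- c) N * Cpow (- f) N * Cpow (w * e) N) / (oA * Cpow p N) * L);
    [unfold Cdiv; ring | rewrite Hpow; field; auto].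
Qed.

Lemma vwp_limit (q a z c f b d e A : Cx) :
  let p := q * q in
  q <> Czero -> (Cnorm q < 1)%R -> b * d * z <> Czero -> A = - (a * z / q) ->
  a <> Czero -> c <> Czero -> f <> Czero -> A <> Czero ->
  lreg a p -> lreg c p -> lreg f p -> reg b p -> reg d p -> reg e p -> reg A p ->
  qinf (A * p) p <> Czero -> qinf (p / A) p <> Czero ->
  exists T, bisum_cv (vwp_term q a z c f b d e) T /\
    Ccv (wsum (qpoch p p) (fun i => Cinv (qpoch p p i * qpoch (A * p) p i))
           (fun j => Cinv (qpoch p p j * qpoch (p / A) p j)) (vwp_term q a z c f b d e))
        (T / (qinf p p * qinf (A * p) p * qinf (p / A) p)).
Proof.
  intros p Hq0 Hq Hbdz HAe Ha0 Hc0 Hf0 HA0 Ha Hc Hf Hb Hd He HA H1 H2.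
  pose proof (Cmul_neq_0 q q Hq0 Hq0) as Hp0; pose proof (Cnorm_sqr_lt_1 q Hq) as Hp; fold p in Hp0, Hp.
  pose proof (qpoch_cv p p Hp0 Hp) as HP; pose proof (qinf_neq_0 p p Hp0 Hp Hp) as HP0.
  destruct (vwp_term_geometric q a z c f b d e A) as [G1 G2]; try assumption.
  destruct (wsum_limit (qpoch p p) (fun i => Cinv (qpoch p p i * qpoch (A * p) p i))
    (fun j => Cinv (qpoch p p j * qpoch (p / A) p j)) (vwp_term q a z c f b d e) _ _ _ HP
    (Ccv_inv _ _ (Cmul_neq_0 _ _ HP0 H1) (Ccv_mul _ _ _ _ HP (qpoch_cv (A * p) p Hp0 Hp)))
    (Ccv_inv _ _ (Cmul_neq_0 _ _ HP0 H2) (Ccv_mul _ _ _ _ HP (qpoch_cv (p / A) p Hp0 Hp)))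
    G1 G2) as [T [HT HL]].
  exists T; split; [exact HT |].
  eapply Ccv_eq; [exact HL | field; auto].
Qed.

Theorem mainTheorem9 (a b d z q : Cx) :
  Cnorm q < 1 -> q <> Czero ->
  a <> Czero -> b <> Czero -> d <> Czero -> z <> Czero ->
  (* denominators of G_6 *)
  (forall r : Z, qdef a (q * q)%Cx r /\ qnz b (q * q)%Cx r /\ qnz d (q * q)%Cx r) ->
  (* (i) *)
  (Cnorm ((b * d) / (a * z * q))%Cx < 1 ->
    (forall r : Z, qdef (- (a * z * q) / b)%Cx (q * q)%Cx r /\
                   qdef (- (a * z * q) / d)%Cx (q * q)%Cx r /\
                   qnz (- (z * q))%Cx (q * q)%Cx r) ->
    qinf b (q * q)%Cx <> Czero -> qinf d (q * q)%Cx <> Czero ->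
    qinf ((q * q) / a)%Cx (q * q)%Cx <> Czero ->
    exists S T : Cx,
      bisum_cv (G6term a b d z q) S /\
      bisum_cv (fun r : Z =>
         ((qpochZ (- (a * z * q) / b)%Cx (q * q)%Cx r
           * qpochZ (- (a * z * q) / d)%Cx (q * q)%Cx r)
          / qpochZ (- (z * q))%Cx (q * q)%Cx r
          * Cpowz (- (b * d) / (a * z * q))%Cx r)%Cx) T /\
      S = ((qinf (- (z * q))%Cx (q * q)%Cx
            * qinf (- (q * b) / (a * z))%Cx (q * q)%Cx
            * qinf (- (q * d) / (a * z))%Cx (q * q)%Cx)
           / (qinf b (q * q)%Cx * qinf d (q * q)%Cx * qinf ((q * q) / a)%Cx (q * q)%Cx)
           * T)%Cx)
  /\
  (* (ii) *)
  (Cnorm ((b * d) / (a * z * q))%Cx < 1 -> Cnorm (b / a)%Cx < 1 ->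
    (forall r : Z, qdef (- (a * z * q) / b)%Cx (q * q)%Cx r) ->
    qinf b (q * q)%Cx <> Czero ->
    qinf (- (b * d) / (a * z * q))%Cx (q * q)%Cx <> Czero ->
    exists S T : Cx,
      bisum_cv (G6term a b d z q) S /\
      bisum_cv (fun r : Z =>
         ((qpochZ (- (a * z * q) / b)%Cx (q * q)%Cx r * qpochZ a (q * q)%Cx r)
          / qpochZ d (q * q)%Cx r
          * Cpowz (b / a)%Cx r)%Cx) T /\
      S = ((qinf (b / a)%Cx (q * q)%Cx * qinf (- (q * b) / (a * z))%Cx (q * q)%Cx)
           / (qinf b (q * q)%Cx * qinf (- (b * d) / (a * z * q))%Cx (q * q)%Cx)
           * T)%Cx)
  /\
  (* (iii) *)
  (Cnorm ((b * d) / (a * z * q))%Cx < 1 ->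
    (forall r : Z, qdef (- (a * z * q) / b)%Cx (q * q)%Cx r /\
                   qdef (- (a * z * q) / d)%Cx (q * q)%Cx r /\
                   qnz (- (z * q))%Cx (q * q)%Cx r) ->
    (Cone + (a * z) / q)%Cx <> Czero ->
    qinf (- (b * d) / (a * q * z))%Cx (q * q)%Cx <> Czero ->
    qinf (- (q * q * q) / (a * z))%Cx (q * q)%Cx <> Czero ->
    qinf (- (a * q * z))%Cx (q * q)%Cx <> Czero ->
    exists S T : Cx,
      bisum_cv (G6term a b d z q) S /\
      bisum_cv (fun r : Z =>
         (((Cone + a * z * Cpowz q (4 * r - 1)%Z)
           * (qpochZ a (q * q)%Cx r
              * qpochZ (- (a * z * q) / b)%Cx (q * q)%Cx r
              * qpochZ (- (a * z * q) / d)%Cx (q * q)%Cx r)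
           * Cpowz (b * d * z)%Cx r
           * Cpowz q (3 * r * r - 4 * r)%Z)
          / ((Cone + (a * z) / q)
             * (qpochZ b (q * q)%Cx r * qpochZ d (q * q)%Cx r
                * qpochZ (- (z * q))%Cx (q * q)%Cx r)))%Cx) T /\
      S = ((qinf (- (b * q) / (a * z))%Cx (q * q)%Cx
            * qinf (- (d * q) / (a * z))%Cx (q * q)%Cx
            * qinf (- (q * z))%Cx (q * q)%Cx)
           / (qinf (- (b * d) / (a * q * z))%Cx (q * q)%Cx
              * qinf (- (q * q * q) / (a * z))%Cx (q * q)%Cx
              * qinf (- (a * q * z))%Cx (q * q)%Cx)
           * T)%Cx).
Proof.
  intros Hq Hq0 Ha0 Hb0 Hd0 Hz0 Hden.
  pose proof (Cmul_neq_0 q q Hq0 Hq0) as Hp0; pose proof (Cnorm_sqr_lt_1 q Hq) as Hp.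
  set (p := q * q) in *.
  assert (Hpp : forall n, qpoch p p n <> Czero) by (intros; apply qpoch_p_neq_0; assumption).
  pose proof (qinf_neq_0 p p Hp0 Hp Hp) as HP0.
  assert (Ha : lreg a p) by (apply lreg_of_qdef; [exact Hp0 | intros; apply Hden]).
  assert (Hb : reg b p) by (apply reg_of_qnz; [exact Hp0 | intros; apply Hden]).
  assert (Hd : reg d p) by (apply reg_of_qnz; [exact Hp0 | intros; apply Hden]).
  set (w := - (b * d) / (a * z * q)) in *.
  set (c := - (a * z * q) / b) in *.
  set (f := - (a * z * q) / d) in *.
  set (e := - (z * q)) in *.
  assert (Hazq : a * z * q <> Czero) by auto using Cmul_neq_0.
  assert (Hw0 : w <> Czero) by (apply Cdiv_neq_0; [apply Copp_neq_0, Cmul_neq_0 |]; assumption).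
  assert (Hc0 : c <> Czero) by (apply Cdiv_neq_0; [apply Copp_neq_0 |]; assumption).
  assert (Hf0 : f <> Czero) by (apply Cdiv_neq_0; [apply Copp_neq_0 |]; assumption).
  assert (Habd : - (b * d) = a * w * (z * q)) by (unfold w; field; auto).
  assert (Hwc : w * c = d) by (unfold w, c; field; auto).
  assert (Hwf : w * f = b) by (unfold w, f; field; auto).
  (* Reflection of c and f thus produces the products on -qb/(az) and -qd/(az). *)
  assert (Hpc : p / c = - (q * b) / (a * z)).
  { assert (- (a * z * q) <> Czero) by (apply Copp_neq_0; assumption).
    unfold p, c; field; auto. }
  assert (Hpf : p / f = - (q * d) / (a * z)).
  { assert (- (a * z * q) <> Czero) by (apply Copp_neq_0; assumption).
    unfold p, f; field; auto. }
  assert (Hwnorm : Cnorm w = Cnorm (b * d / (a * z * q))).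
  { rewrite <- (Cnorm_opp (b * d / (a * z * q))); f_equal; unfold w, Cdiv; ring. }
  split; [| split].
  - intros Hconv Hden1 HbI HdI HaI.
    assert (Hc : lreg c p) by (apply lreg_of_qdef; [exact Hp0 | intros; apply Hden1]).
    assert (Hf : lreg f p) by (apply lreg_of_qdef; [exact Hp0 | intros; apply Hden1]).
    assert (He : reg e p) by (apply reg_of_qnz; [exact Hp0 | intros; apply Hden1]).
    assert (Hw1 : (Cnorm w < 1)%R) by (rewrite Hwnorm; exact Hconv).
    destruct (G6term_limit a b d z q w Hq0 Hq Ha0 Hz0 Hconv Ha Hb Hd) as [G [HG HGl]].
    destruct (psi21_limit p c f e w Hp0 Hp Hc0 Hf0 Hw0 Hw1 Hc Hf He) as [T [HT HTl]].
    exists G, T; split; [exact HG | split; [exact HT |]].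
    (* (w;p)_oo arises on both sides, from (w;p)_i with G_6 and from (w;p)_j with the new series;
       being nonzero for |w| < 1, it cancels. *)
    pose proof (qinf_neq_0 w p Hp0 Hp Hw1) as HwI.
    assert (E : qinf b p * qinf d p * qinf (p / a) p * (qinf w p / qinf p p * G)
                = qinf e p * qinf (p / c) p * qinf (p / f) p * (qinf w p / qinf p p * T)).
    { eapply Ccv_unique; [apply Ccv_mul; [repeat apply Ccv_mul; apply qpoch_cv; assumption | exact HGl] |].
      eapply Ccv_ext; [intros N; symmetry; apply (G6_finite_i a b d z q w c f e N); auto |].
      apply Ccv_mul; [repeat apply Ccv_mul; apply qpoch_cv; assumption | exact HTl]. }
    rewrite Hpc, Hpf in E.
    apply (Cmul_cancel_l (qinf b p * qinf d p * qinf (p / a) p * (qinf w p / qinf p p)));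
      [auto using Cmul_neq_0, Cdiv_neq_0 |].
    transitivity (qinf b p * qinf d p * qinf (p / a) p * (qinf w p / qinf p p * G)); [ring |].
    rewrite E; field; auto.
  - intros Hconv Hba Hden2 HbI HwI.
    assert (Hc : lreg c p) by (apply lreg_of_qdef; [exact Hp0 | intros; apply Hden2]).
    assert (Hba0 : b / a <> Czero) by (apply Cdiv_neq_0; assumption).
    destruct (G6term_limit a b d z q w Hq0 Hq Ha0 Hz0 Hconv Ha Hb Hd) as [G [HG HGl]].
    destruct (psi21_limit p c a d (b / a) Hp0 Hp Hc0 Ha0 Hba0 Hba Hc Ha Hd) as [T [HT HTl]].
    exists G, T; split; [exact HG | split; [exact HT |]].
    (* The weight of the new series is (b/a;p)_j, so (w;p)_oo does not cancel and ends up in the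
       denominator. *)
    assert (E : qinf b p * (qinf w p / qinf p p * G)
                = qinf (p / c) p * (qinf (b / a) p / qinf p p * T)).
    { eapply Ccv_unique; [apply Ccv_mul; [repeat apply Ccv_mul; apply qpoch_cv; assumption | exact HGl] |].
      eapply Ccv_ext; [intros N; symmetry; apply (G6_finite_ii a b d z q w c N); auto |].
      apply Ccv_mul; [repeat apply Ccv_mul; apply qpoch_cv; assumption | exact HTl]. }
    rewrite Hpc in E.
    apply (Cmul_cancel_l (qinf b p * (qinf w p / qinf p p))); [auto using Cmul_neq_0, Cdiv_neq_0 |].
    transitivity (qinf b p * (qinf w p / qinf p p * G)); [ring |].
    rewrite E; field; auto.
  - intros Hconv Hden3 H1A HwI HpAI HApI.
    (* With this A one has 1 - A = 1 + az/q, A p = -azq and p/A = -q^3/(az), so the hypotheses on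
       these three quantities give [reg A p]. *)
    set (A := - (a * z / q)).
    assert (HA0 : A <> Czero) by (unfold A; auto using Copp_neq_0, Cmul_neq_0, Cdiv_neq_0).
    replace (a * q * z) with (a * z * q) in HwI, HApI |- * by ring; fold w in HwI |- *.
    replace (- (p * q) / (a * z)) with (p / A) in HpAI |- *.
    2:{ assert (- (a * z) <> Czero) by auto using Copp_neq_0, Cmul_neq_0.
        unfold p, A; field; auto. }
    replace (- (a * z * q)) with (A * p) in HApI |- * by (unfold p, A; field; exact Hq0).
    replace (- (b * q) / (a * z)) with (p / c) by (rewrite Hpc; unfold Cdiv; ring).
    replace (- (d * q) / (a * z)) with (p / f) by (rewrite Hpf; unfold Cdiv; ring).
    replace (- (q * z)) with e by (unfold e; ring).
    assert (Hc : lreg c p) by (apply lreg_of_qdef; [exact Hp0 | intros; apply Hden3]).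
    assert (Hf : lreg f p) by (apply lreg_of_qdef; [exact Hp0 | intros; apply Hden3]).
    assert (He : reg e p) by (apply reg_of_qnz; [exact Hp0 | intros; apply Hden3]).
    assert (HA : reg A p).
    { apply reg_of_qinf; try assumption; intros E; apply H1A; rewrite <- E; unfold A; ring. }
    assert (Hbdz : b * d * z <> Czero) by auto using Cmul_neq_0.
    destruct (G6term_limit a b d z q w Hq0 Hq Ha0 Hz0 Hconv Ha Hb Hd) as [G [HG HGl]].
    destruct (vwp_limit q a z c f b d e A Hq0 Hq Hbdz eq_refl Ha0 Hc0 Hf0 HA0
                Ha Hc Hf Hb Hd He HA HApI HpAI) as [T [HT HTl]].
    exists G, T; split; [exact HG | split; [exact HT |]].
    assert (E : qinf w p / qinf p p * G
                = qinf e p * qinf (p / c) p * qinf (p / f) p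
                  * (T / (qinf p p * qinf (A * p) p * qinf (p / A) p))).
    { eapply Ccv_unique; [exact HGl |].
      eapply Ccv_ext; [intros N; symmetry; apply (G6_finite_iii a b d z q w c f e A N); auto |].
      - intros n; apply qpoch_neq_0_of_qinf; assumption.
      - intros n; apply qpoch_neq_0_of_qinf; assumption.
      - apply Ccv_mul; [repeat apply Ccv_mul; apply qpoch_cv; assumption | exact HTl]. }
    apply (Cmul_cancel_l (qinf w p / qinf p p)); [apply Cdiv_neq_0; assumption |].
    rewrite E; field; auto.
Qed.
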